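(* There exists $n_0\in\mathbb{N}$ such that for every integer $n\ge n_0$ we have $R(P^t_n,\mathbb{F})=2n-1$.
   Context: All hypergraphs are $3$-uniform. For $3$-uniform hypergraphs $G,H$, the Ramsey number $R(G,H)$ is the least integer $N$ such that every red-blue colouring of the edges of the complete $3$-uniform hypergraph $K_N^{(3)}$ on $N$ vertices contains a red copy of $G$ or a blue copy of $H$. The Fano plane $\mathbb{F}$ is the unique $3$-uniform hypergraph with seven vertices and seven edges in which every pair of vertices is contained in exactly one edge. The tight path $P^t_n$ on $n$ vertices has distinct vertices $v_1,\dots,v_n$ and edges $e_1,\dots,e_{n-2}$ with $e_i=\{v_i,v_{i+1},v_{i+2}\}$. *)

(* Defs.v *)
From mathcomp Require Import all_boot all_algebra.

Set Implicit Arguments.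
Unset Strict Implicit.
Unset Printing Implicit Defensive.

Record hypergraph3 (V : finType) := Hypergraph3 {
  edges : {set {set V}};
  edges_card3 : forall e, e \in edges -> #|e| = 3
}.

Definition contains_copy (V W : finType)
    (H : hypergraph3 V) (G : hypergraph3 W) : Prop :=
  exists2 f : W -> V, injective f
    & forall e : {set W}, e \in edges G -> f @: e \in edges H.

Lemma complete3_card (N : nat) (e : {set 'I_N}) :
  e \in [set e : {set 'I_N} | #|e| == 3] -> #|e| = 3.
Proof. by rewrite inE => /eqP. Qed.

Definition complete3 (N : nat) : hypergraph3 'I_N :=
  Hypergraph3 (@complete3_card N).

Lemma colour_class_card (V : finType) (K : hypergraph3 V)
    (c : {set V} -> bool) (b : bool) (e : {set V}) :
  e \in [set e in edges K | c e == b] -> #|e| = 3.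
Proof. by rewrite inE => /andP[/edges_card3]. Qed.

(* A colouring of the edges of K is given by any c : {set V} -> bool; its
   values outside of edges K play no role. *)
Definition colour_class (V : finType) (K : hypergraph3 V)
    (c : {set V} -> bool) (b : bool) : hypergraph3 V :=
  Hypergraph3 (@colour_class_card V K c b).

(* Red is true and blue is false. *)
Definition ramsey_arrow (N : nat) (V W : finType)
    (G : hypergraph3 V) (H : hypergraph3 W) : Prop :=
  forall c : {set 'I_N} -> bool,
    contains_copy (colour_class (complete3 N) c true) G \/
    contains_copy (colour_class (complete3 N) c false) H.

(* R(G, H) = N *)
Definition is_ramsey_number (V W : finType)
    (G : hypergraph3 V) (H : hypergraph3 W) (N : nat) : Prop :=
  ramsey_arrow N G H /\ forall M : nat, ramsey_arrow M G H -> N <= M.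

Definition tight_path_edges (n : nat) : {set {set 'I_n}} :=
  [set e : {set 'I_n} | [exists x : 'I_n, exists y : 'I_n, exists z : 'I_n,
     [&& y == x.+1 :> nat, z == x.+2 :> nat & e == [set x; y; z]]]].

Lemma tight_path_card (n : nat) (e : {set 'I_n}) :
  e \in tight_path_edges n -> #|e| = 3.
Proof.
rewrite inE => /existsP[x /existsP[y /existsP[z /and3P[/eqP yE /eqP zE /eqP->]]]].
rewrite setUC cardsU1 cards2 !inE -!val_eqE /= yE zE.
by rewrite (gtn_eqF (leqnSn _)) (gtn_eqF (ltnSn _)) (ltn_eqF (ltnSn _)).
Qed.

Definition tight_path (n : nat) : hypergraph3 'I_n :=
  Hypergraph3 (@tight_path_card n).

Definition fano_plane (V : finType) (F : hypergraph3 V) : Prop :=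
  [/\ #|V| = 7, #|edges F| = 7
    & forall x y : V, x != y ->
        exists! e : {set V}, e \in edges F /\ [set x; y] \subset e].

(* The lines {i, i + 1, i + 3} modulo 7 witness that fano_plane is inhabited. *)
Definition fano_line (i : 'I_7) : {set 'I_7} :=
  [set i; i + 1; i + 3%:R]%R.

Lemma fano_line_card (e : {set 'I_7}) :
  e \in fano_line @: [set: 'I_7] -> #|e| = 3.
Proof.
move=> /imsetP[i _ ->]; rewrite /fano_line setUC cardsU1 cards2 !inE.
by case: i; do 7?[case=> //].
Qed.

Lemma fano_plane_exists :
  exists F : hypergraph3 'I_7, fano_plane F.
Proof.
have inP x y i : ([set x; y] \subset fano_line i) =
    (x \in [:: i; i + 1; i + 3%:R]%R) && (y \in [:: i; i + 1; i + 3%:R]%R).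
  by rewrite subUset !sub1set !inE -!orbA.
have key (x y : 'I_7) : x != y -> exists2 i : 'I_7, [set x; y] \subset fano_line i
    & forall j : 'I_7, [set x; y] \subset fano_line j -> j = i.
  pose P (x y i : nat) :=
    let l := [:: i; (i + 1) %% 7; (i + 3) %% 7] in (x \in l) && (y \in l).
  have PE (a b i : 'I_7) : ([set a; b] \subset fano_line i) = P a b i.
    by rewrite inP /P !inE -!val_eqE.
  have H : all (fun a => all (fun b => (a != b) ==>
      has (fun i => P a b i && all (fun j => P a b j ==> (j == i)) (iota 0 7))
        (iota 0 7)) (iota 0 7)) (iota 0 7) by vm_compute.
  have I7 (a : 'I_7) : (a : nat) \in iota 0 7 by rewrite mem_iota /=.
  move=> xy; have {H}/allP Hx := allP H _ (I7 x).
  have /implyP/(_ xy) := Hx _ (I7 y).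
  case/hasP=> i; rewrite mem_iota add0n => i7 /andP[Pi /allP ui].
  exists (Ordinal i7); first by rewrite PE.
  by move=> j; rewrite PE => Pj; apply/val_inj/eqP; have /implyP := ui _ (I7 j); apply.
exists (Hypergraph3 fano_line_card); split=> /=.
- by rewrite card_ord.
- rewrite card_imset ?cardsT ?card_ord // => i j ij.
  have ne : i != (i + 1)%R by case: i {ij}; do 7?[case=> //].
  have [k _ uk] := key _ _ ne.
  have uki l : fano_line l = fano_line i -> l = k.
    by move=> li; apply: uk; rewrite li subUset !sub1set !inE !eqxx !orbT.
  by rewrite (uki i) // (uki j).
- move=> x y /key[i xyi ui]; exists (fano_line i); split.
    by split=> //; apply: imset_f.
  by move=> _ [/imsetP[j _ ->] /ui ->].
Qed.

(* Main.v *)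
Require Import Defs.
From mathcomp Require Import all_boot.
From mathcomp Require Import zify.
From Stdlib Require Import Classical.

(* Lower bound: split 2n - 2 vertices into two halves, with the triples inside a
   half red and all others blue. A red tight path stays inside a half, and the
   blue triples form a 2-colourable hypergraph, which the Fano plane is not.

   Upper bound: assume that there is no blue Fano plane. By Ramsey's theorem
   every large set contains a big red clique. If two disjoint red cliques A, B
   are not joined by a red tight path a a' b b', then on large subsets all
   triples AAB (or all ABB) are blue. Then every further vertex v is attached to
   one of them: v is in few blue triples with two vertices of A or in none with
   two vertices of B, so it can be inserted into a red path that ends with the
   vertices of that clique. Hence two disjoint red paths with such ends absorb
   all remaining vertices, and one of them has at least n vertices. If there are
   three pairwise unjoined cliques, the orientation above is cyclic, because a
   transitive one contains a blue Fano plane. Either some vertex joins two of the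
   three cliques after all, and a bounded number of merges leaves two paths, or
   every vertex is coloured like those of A, of B or of C. In the latter case the
   three classes are red cliques, the triples with two vertices in one class and
   one in its predecessor are red, and the path is explicit. *)

Set Implicit Arguments.
Unset Strict Implicit.
Unset Printing Implicit Defensive.

(** * Ramsey theorems *)

(** Among [2 * n - 1] vertices, two disjoint paths guarantee one of order n only if they cover
    everything, whereas a single path may omit up to n - 1 vertices. Hence joining two paths into
    one may waste bounded sets, and once they cannot be joined every leftover vertex must be
    absorbed. The absorbers are hubs: red cliques kept outside the paths, of size proportional to
    the bounded number of leftover vertices, because each insertion consumes four reorderable
    vertices of an end.

    Hubs come from two sources. Without a cyclic triple of a fixed size, two unjoined cliques serve
    and at most two paths remain, unless all large disjoint cliques are joined and one path
    suffices. With a cyclic triple that has a bridge, the triple itself serves; at most three paths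
    remain, and the bridge makes up for the third hub. The constants are nested Ramsey bounds,
    chosen in the order [N1], [s], [N2], [N3], each depending only on earlier ones. *)

Lemma pickn (T : finType) (X D : {set T}) (k : nat) :
  k + #|D| <= #|X| ->
  exists s : seq T,
    [/\ size s = k, uniq s & forall x, x \in s -> (x \in X) && (x \notin D)].
Proof.
move=> kX; have kXD : k <= #|X :\: D|.
  by have := cardsID D X; have := subset_leq_card (subsetIr X D); lia.
exists (take k (enum (X :\: D))); split.
- by rewrite size_take -cardE; case: ltnP => // ?; lia.
- by rewrite take_uniq ?enum_uniq.
- by move=> x /mem_take; rewrite mem_enum inE andbC.
Qed.

Lemma subset_card (T : finType) (X : {set T}) (k : nat) :
  k <= #|X| -> exists2 Y : {set T}, Y \subset X & #|Y| = k.
Proof.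
move=> kX; have [|s [sk us sX]] := @pickn T X set0 k; first by rewrite cards0 addn0.
exists [set x in s]; first by apply/subsetP=> x; rewrite inE => /sX/andP[].
by rewrite cardsE (card_uniqP us).
Qed.

Lemma cards_seq (T : finType) (s : seq T) : #|[set x in s]| <= size s.
Proof. by rewrite cardsE card_size. Qed.

Lemma card_sep (T : finType) (S : {set T}) (p : pred T) (b : bool) :
  #|[set x in S | p x == b]| + #|[set x in S | p x == ~~ b]| = #|S|.
Proof.
rewrite -(cardsID [set x | p x == b] S); congr (_ + _); apply: eq_card => x; rewrite !inE //.
by case: (p x); case: b; rewrite ?andbF ?andbT.
Qed.

Lemma ramsey2 (k l : nat) : exists N : nat,
  forall (T : finType) (e : rel T) (S : {set T}), symmetric e -> N <= #|S| ->
  (exists A : {set T}, [/\ A \subset S, #|A| = k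
     & {in A &, forall x y, x != y -> e x y}]) \/
  (exists A : {set T}, [/\ A \subset S, #|A| = l
     & {in A &, forall x y, x != y -> ~~ e x y}]).
Proof.
have [n] := ubnP (k + l); elim: n k l => // n IHn [|k] [|l] leN; try
  by exists 0 => T e S _ _;
    ((by left; exists set0; split; rewrite ?sub0set ?cards0 // => x y; rewrite inE)
     || (by right; exists set0; split; rewrite ?sub0set ?cards0 // => x y; rewrite inE)).
have [|N1 H1] := IHn k l.+1; first by lia.
have [|N2 H2] := IHn k.+1 l; first by lia.
exists (N1 + N2).+1 => T e S eC cS.
have /card_gt0P[x xS] : 0 < #|S| by lia.
pose X := [set y in S :\ x | e x y == true]; pose Y := [set y in S :\ x | e x y == false].
have cXY : #|X| + #|Y| = #|S|.-1.
  by rewrite (card_sep _ (e x) true) (cardsD1 x S) xS.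
have ext (b : bool) (Z A : {set T}) : Z \subset S :\ x -> {in Z, forall y, e x y = b} ->
    A \subset Z -> {in A &, forall y z, y != z -> e y z = b} ->
    [/\ x |: A \subset S, #|x |: A| = #|A|.+1
      & {in x |: A &, forall y z, y != z -> e y z = b}].
  move=> ZS xZ AZ hA; have AS := subset_trans AZ ZS.
  have xA : x \notin A by apply/negP=> /(subsetP AS); rewrite !inE eqxx.
  split; first by rewrite subUset sub1set xS (subset_trans AS (subsetDl _ _)).
    by rewrite cardsU1 xA.
  move=> y z /setU1P[->|yA] /setU1P[->|zA]; rewrite ?eqxx // => yz.
  - by rewrite xZ ?(subsetP AZ).
  - by rewrite eC xZ ?(subsetP AZ).
  - exact: hA.
have XS : X \subset S :\ x by apply/subsetP=> y; rewrite inE => /andP[].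
have YS : Y \subset S :\ x by apply/subsetP=> y; rewrite inE => /andP[].
have XE : {in X, forall y, e x y = true} by move=> y; rewrite inE => /andP[_ /eqP].
have YE : {in Y, forall y, e x y = false}.
  by move=> y; rewrite inE => /andP[_ /eqP].
have [cX|cX] := leqP N1 #|X|.
  have [[A [AX cA hA]]|[A [AX cA hA]]] := H1 T e X eC cX; last first.
    right; exists A; split=> //; apply: subset_trans AX (subset_trans XS (subsetDl _ _)).
  by left; exists (x |: A); have [? -> hh] := ext true X A XS XE AX hA; rewrite cA.
have cY : N2 <= #|Y| by lia.
have [[A [AX cA hA]]|[A [AX cA hA]]] := H2 T e Y eC cY.
  left; exists A; split=> //; apply: subset_trans AX (subset_trans YS (subsetDl _ _)).
right; exists (x |: A); have [|? -> hh] := ext false Y A YS YE AX.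
  by move=> y z yA zA yz; apply/negbTE/hA.
by rewrite cA; split=> // y z yA zA yz; rewrite hh.
Qed.

Definition homogeneous (T : finType) (c : {set T} -> bool) (b : bool) (A : {set T}) :=
  forall x y z, x \in A -> y \in A -> z \in A -> x != y -> x != z -> y != z ->
  c [set x; y; z] = b.

Lemma set3C12 (T : finType) (x y z : T) : [set x; y; z] = [set y; x; z].
Proof. by rewrite [[set x; y]]setUC. Qed.

Lemma set3C23 (T : finType) (x y z : T) : [set x; y; z] = [set x; z; y].
Proof. by rewrite setUAC. Qed.

(** With r the graph Ramsey number, the recursion is R(k+1, l+1) <= r(R(k, l+1), R(k+1, l)) + 1. In
    the link graph of a vertex x, [ramsey2] finds a set on which all triples through x have one
    colour; x then extends every clique of that colour inside it. *)
Lemma ramsey3 (k l : nat) : exists N : nat,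
  forall (T : finType) (c : {set T} -> bool) (S : {set T}), N <= #|S| ->
  (exists A : {set T}, [/\ A \subset S, #|A| = k & homogeneous c true A]) \/
  (exists A : {set T}, [/\ A \subset S, #|A| = l & homogeneous c false A]).
Proof.
have [n] := ubnP (k + l); elim: n k l => // n IHn [|k] [|l] leN; try
  by exists 0 => T c S _;
    ((by left; exists set0; split; rewrite ?sub0set ?cards0 // => x y z; rewrite inE)
     || (by right; exists set0; split; rewrite ?sub0set ?cards0 // => x y z; rewrite inE)).
have [|N1 H1] := IHn k l.+1; first by lia.
have [|N2 H2] := IHn k.+1 l; first by lia.
have [N HN] := ramsey2 N1 N2.
exists N.+1 => T c S cS.
have /card_gt0P[x xS] : 0 < #|S| by lia.
have cSx : N <= #|S :\ x| by move: cS; rewrite (cardsD1 x S) xS.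
have ext (b : bool) (Z A : {set T}) : Z \subset S :\ x ->
    {in Z &, forall y z, y != z -> c [set x; y; z] = b} ->
    A \subset Z -> homogeneous c b A ->
    [/\ x |: A \subset S, #|x |: A| = #|A|.+1 & homogeneous c b (x |: A)].
  move=> ZS xZ AZ hA; have AS := subset_trans AZ ZS.
  have xA : x \notin A by apply/negP=> /(subsetP AS); rewrite !inE eqxx.
  split; first by rewrite subUset sub1set xS (subset_trans AS (subsetDl _ _)).
    by rewrite cardsU1 xA.
  move=> y z t /setU1P[->|yA] /setU1P[->|zA] /setU1P[->|tA]; rewrite ?eqxx // => yz yt zt.
  - by rewrite xZ ?(subsetP AZ).
  - by rewrite set3C12 xZ ?(subsetP AZ).
  - by rewrite set3C23 set3C12 xZ ?(subsetP AZ).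
  - exact: hA.
have [|[Z [ZS cZ hZ]]|[Z [ZS cZ hZ]]] := HN T (fun y z => c [set x; y; z]) (S :\ x) _ cSx.
  by move=> y z; rewrite set3C23.
- have [|[A [AZ cA hA]]|[A [AZ cA hA]]] := H1 T c Z; rewrite ?cZ //.
    left; exists (x |: A); have [? -> hh] := ext true Z A ZS hZ AZ hA.
    by rewrite cA.
  right; exists A; split=> //; apply: subset_trans AZ (subset_trans ZS (subsetDl _ _)).
have [|[A [AZ cA hA]]|[A [AZ cA hA]]] := H2 T c Z; rewrite ?cZ //.
  left; exists A; split=> //; apply: subset_trans AZ (subset_trans ZS (subsetDl _ _)).
right; exists (x |: A); have [|? -> hh] := ext false Z A ZS _ AZ hA.
  by move=> y z yZ zZ yz; apply/negbTE/hZ.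
by rewrite cA.
Qed.

(** Columns are taken from Y one at a time, and each keeps the larger of its two classes in X, at
    the cost of a factor 2. The colour may still vary with the column, hence the predicate [b]. *)
Lemma bipartite_columns (m t : nat) (T : finType) (r : rel T) (X Y : {set T}) :
  t * 2 ^ m <= #|X| -> m <= #|Y| ->
  exists X' Y' : {set T}, exists b : pred T,
    [/\ X' \subset X, Y' \subset Y, t <= #|X'|, #|Y'| = m
      & {in X' & Y', forall x y, r x y = b y}].
Proof.
elim: m X Y => [|m IHm] X Y cX cY.
  exists X, set0, xpred0; rewrite sub0set cards0; split=> //; first by rewrite muln1 in cX.
  by move=> x y _; rewrite inE.
have /card_gt0P[y yY] : 0 < #|Y| by lia.
have cY' : m <= #|Y :\ y| by move: cY; rewrite (cardsD1 y Y) yY.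
pose Z b := [set x in X | r x y == b].
have [b cZ] : exists b, t * 2 ^ m <= #|Z b|.
  have := card_sep X (r^~ y) true; rewrite -/(Z true) -/(Z false).
  have [|lt] := leqP (t * 2 ^ m) #|Z true|; first by exists true.
  by move=> E; exists false; rewrite expnS in cX; lia.
have [X' [Y' [b' [XZ YY cX' cY'' H]]]] := IHm (Z b) (Y :\ y) cZ cY'.
have yY' : y \notin Y' by apply/negP=> /(subsetP YY); rewrite !inE eqxx.
exists X', (y |: Y'), (fun z => if z == y then b else b' z); split=> //.
- by apply: subset_trans XZ _; apply/subsetP=> x; rewrite inE => /andP[].
- by rewrite subUset sub1set yY (subset_trans YY (subsetDl _ _)).
- by rewrite cardsU1 yY' cY''.
- move=> x z xX' /setU1P[->|zY']; rewrite ?eqxx.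
    by have := subsetP XZ x xX'; rewrite inE => /andP[_ /eqP].
  by rewrite ifN ?H //; apply: contraNneq yY' => <-.
Qed.

(** Of [t.*2] constant columns, t share a colour. *)
Lemma bipartite_ramsey (t : nat) (T : finType) (r : rel T) (X Y : {set T}) :
  t * 2 ^ t.*2 <= #|X| -> t.*2 <= #|Y| ->
  exists X' Y' : {set T}, exists b : bool,
    [/\ X' \subset X, Y' \subset Y, #|X'| = t, #|Y'| = t
      & {in X' & Y', forall x y, r x y = b}].
Proof.
move=> cX cY; have [X1 [Y1 [b [X1X Y1Y cX1 cY1 H]]]] := bipartite_columns r cX cY.
have [X' X'X1 cX'] := subset_card cX1.
pose Z d := [set y in Y1 | b y == d].
have [d cZ] : exists d, t <= #|Z d|.
  have := card_sep Y1 b true; rewrite -/(Z true) -/(Z false).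
  have [|lt] := leqP t #|Z true|; first by exists true.
  by rewrite cY1 => E; exists false; lia.
have [Y' Y'Z cY'] := subset_card cZ.
have ZY : Z d \subset Y1 by apply/subsetP=> y; rewrite inE => /andP[].
exists X', Y', d; split=> //; first exact: subset_trans X'X1 X1X.
  exact: subset_trans Y'Z (subset_trans ZY Y1Y).
move=> x y xX' yY'; have := subsetP Y'Z y yY'; rewrite inE => /andP[yY1 /eqP <-].
by apply: H => //; apply: subsetP X'X1 x xX'.
Qed.

(** * Red and blue triples without a blue Fano plane *)

Ltac distinct us :=
  let E := fresh in
  apply/eqP=> E; move: us; rewrite E /= !inE ?eqxx /= ?orbT ?andbF /=; by [].

Section Colouring.

Context (T : finType) (c : {set T} -> bool).
Implicit Types (x y z v : T) (X Y Z A B C D : {set T}).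

(** Degenerate triples are neither red nor blue, so a coloured triple carries the distinctness of
    its points. *)
Definition red x y z := uniq [:: x; y; z] && c [set x; y; z].
Definition blue x y z := uniq [:: x; y; z] && ~~ c [set x; y; z].

Lemma triple_uniq_swap x y z : uniq [:: x; y; z] = uniq [:: y; x; z].
Proof. by rewrite /= !inE (eq_sym y x) !negb_or; do !case: eqP. Qed.

Lemma triple_uniq_rot x y z : uniq [:: x; y; z] = uniq [:: y; z; x].
Proof. by rewrite -(rot_uniq 1 [:: x; y; z]). Qed.

Lemma set3_rot x y z : [set x; y; z] = [set y; z; x].
Proof. by rewrite set3C12 set3C23. Qed.

Lemma red_swap x y z : red x y z = red y x z.
Proof. by rewrite /red triple_uniq_swap set3C12. Qed.

Lemma red_rot x y z : red x y z = red y z x.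
Proof. by rewrite /red triple_uniq_rot set3_rot. Qed.

Lemma red_rev x y z : red x y z = red z y x.
Proof. by rewrite red_swap red_rot red_rot. Qed.

Lemma blue_swap x y z : blue x y z = blue y x z.
Proof. by rewrite /blue triple_uniq_swap set3C12. Qed.

Lemma blue_rot x y z : blue x y z = blue y z x.
Proof. by rewrite /blue triple_uniq_rot set3_rot. Qed.

Lemma redNblue x y z : uniq [:: x; y; z] -> red x y z = ~~ blue x y z.
Proof. by rewrite /red /blue => ->; rewrite negbK. Qed.

(** The Fano plane is seen as a line x, y, z together with the three perfect matchings of the other
    four points: ab|de belongs to x, ad|be to y and ae|bd to z. Each pair of points lies on one of
    the lines, so [blue] makes all seven distinct. *)
Definition no_fano := forall x y z a b d e,
  blue x y z -> blue x a b -> blue x d e -> blue y a d -> blue y b e ->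
  blue z a e -> blue z b d -> False.

Definition rclique X := forall x y z, x \in X -> y \in X -> z \in X ->
  uniq [:: x; y; z] -> red x y z.

(** This is the arrow from X to Y in the orientation of unjoined cliques. *)
Definition blue2 X Y := forall x x' y, x \in X -> x' \in X -> y \in Y ->
  x != x' -> blue x x' y.

Definition red2 X Y := forall x x' y, x \in X -> x' \in X -> y \in Y ->
  x != x' -> red x x' y.

Definition conn X Y := [exists x in X, exists x' in X, exists y in Y, exists y' in Y,
  red x x' y && red x' y y'].

Lemma connP X Y : reflect (exists x x' y y', [/\ x \in X, x' \in X, y \in Y, y' \in Y
  & red x x' y /\ red x' y y']) (conn X Y).
Proof.
apply: (iffP idP).
  case/exists_inP=> x xX /exists_inP[x' x'X /exists_inP[y yY /exists_inP[y' y'Y /andP[h h']]]].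
  by exists x, x', y, y'.
case=> x [x' [y [y' [xX x'X yY y'Y [h h']]]]].
apply/exists_inP; exists x => //; apply/exists_inP; exists x' => //.
by apply/exists_inP; exists y => //; apply/exists_inP; exists y'; rewrite // h h'.
Qed.

Lemma conn_sym X Y : conn X Y = conn Y X.
Proof.
by apply/connP/connP=> -[x [x' [y [y' [? ? ? ? [h h']]]]]];
  exists y', y, x', x; split=> //; split; rewrite red_rev.
Qed.

Lemma conn_sub X Y X' Y' : X' \subset X -> Y' \subset Y -> conn X' Y' -> conn X Y.
Proof.
move=> /subsetP sX /subsetP sY /connP[x [x' [y [y' [? ? ? ? h]]]]].
by apply/connP; exists x, x', y, y'; split; auto.
Qed.

Lemma rclique_sub X Y : X \subset Y -> rclique Y -> rclique X.
Proof. by move=> /subsetP sX h x y z ? ? ?; apply: h; auto. Qed.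

Lemma blue2_sub X Y X' Y' : X' \subset X -> Y' \subset Y -> blue2 X Y -> blue2 X' Y'.
Proof. by move=> /subsetP sX /subsetP sY h x x' y ? ? ?; apply: h; auto. Qed.

Lemma red2_sub X Y X' Y' : X' \subset X -> Y' \subset Y -> red2 X Y -> red2 X' Y'.
Proof. by move=> /subsetP sX /subsetP sY h x x' y ? ? ?; apply: h; auto. Qed.

Hypothesis noF : no_fano.

(* The 4-set is the complement of a line, which splits 2 + 1. *)
Lemma no_transitive A B C : 4 <= #|A| -> 2 <= #|B| -> 1 <= #|C| ->
  blue2 A B -> blue2 A C -> blue2 B C -> False.
Proof.
move=> cA cB cC AB AC BC.
have [|[|a [|b [|d [|e [|? ?]]]]] [// _ us sA]] := @pickn T A set0 4; first by rewrite cards0.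
have [|[|x [|y [|? ?]]] [// _ us' sB]] := @pickn T B set0 2; first by rewrite cards0.
have /card_gt0P[z zC] := cC.
have inA t : t \in [:: a; b; d; e] -> t \in A by move=> /sA/andP[].
have inB t : t \in [:: x; y] -> t \in B by move=> /sB/andP[].
have xy : x != y by distinct us'.
have [xB yB] : x \in B /\ y \in B by split; apply: inB; rewrite !inE eqxx ?orbT.
have Ab p q t : p \in [:: a; b; d; e] -> q \in [:: a; b; d; e] -> p != q ->
    t \in B :|: C -> blue t p q.
  by move=> /inA pA /inA qA pq /setUP[tB|tC]; rewrite blue_rot; [apply: AB | apply: AC].
apply: (@noF x y z a b d e); first exact: BC.
all: apply: Ab; try (by rewrite !inE ?eqxx ?xB ?yB ?zC ?orbT); distinct us.
Qed.

(** Suppose that v is blue with a pair y, y' of Y and with a pair x, x' of X. A further blue pair a,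
    a' of X disjoint from x, x' would give a blue Fano plane: on the line y, y', v, the point v
    takes the matching xx'|aa' and y, y' take the other two, whose triples are of type XXY. So {x,
    x'} meets all blue pairs of v in X. *)
Lemma link_dichotomy X Y v : blue2 X Y ->
  (exists2 D : {set T}, #|D| <= 2 &
     forall x x', x \in X :\: D -> x' \in X :\: D -> ~~ blue v x x') \/
  (forall y y', y \in Y -> y' \in Y -> ~~ blue v y y').
Proof.
move=> XY.
have [/exists_inP[y yY /exists_inP[y' y'Y vy]]|noY] :=
    boolP [exists y in Y, exists y' in Y, blue v y y']; last first.
  right=> y y' yY y'Y; apply: contra noY => h.
  by apply/exists_inP; exists y => //; apply/exists_inP; exists y'.
left.
have [/exists_inP[x xX /exists_inP[x' x'X vx]]|noX] :=
    boolP [exists x in X, exists x' in X, blue v x x']; last first.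
  exists set0; rewrite ?cards0 // => x x'; rewrite setD0 => xX x'X; apply: contra noX => h.
  by apply/exists_inP; exists x => //; apply/exists_inP; exists x'.
exists [set x; x']; first by rewrite cards2; case: (x == x').
move=> a a'; rewrite !inE !negb_or => /andP[/andP[ax ax'] aX] /andP[/andP[a'x a'x'] a'X].
apply/negP=> va.
have aa' : a != a' by case/andP: va => /=; rewrite !inE; case: (a == a'); rewrite ?andbF.
have xx' : x != x' by case/andP: vx => /=; rewrite !inE; case: (x == x'); rewrite ?andbF.
have xa : x != a by rewrite eq_sym.
have x'a' : x' != a' by rewrite eq_sym.
have xa' : x != a' by rewrite eq_sym.
have yy' : y != y' by case/andP: vy => /=; rewrite !inE; case: (y == y'); rewrite ?andbF.
apply: (@noF y y' v x a a' x') => //; first by rewrite -blue_rot.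
all: by rewrite blue_rot XY // eq_sym.
Qed.

End Colouring.

(** * Pairwise unjoined red cliques *)

(* Locked: the nested values big (big 4) must never be computed. *)
Definition big (t : nat) := locked (t * 2 ^ t.*2).

Lemma double_leq_big t : t.*2 <= big t.
Proof.
rewrite /big -lock -muln2 leq_mul2l; case: t => //= t.
by rewrite -{1}(expn1 2) leq_exp2l.
Qed.

Lemma leq_big t : t <= big t.
Proof. by have := double_leq_big t; lia. Qed.

Lemma leq_of_big t n : big t <= n -> t * 2 ^ t.*2 <= n.
Proof. by rewrite /big -lock. Qed.

Section Triples.

Context (T : finType) (c : {set T} -> bool).
Implicit Types (x y z v : T) (X Y Z A B C D P Q R : {set T}).
Notation red := (red c).
Notation blue := (blue c).
Notation rclique := (rclique c).
Notation blue2 := (blue2 c).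
Notation red2 := (red2 c).
Notation conn := (conn c).

(** The relation made homogeneous says that x y extends backwards to a red triple x1 x y. If it
    always fails, all triples XXY are blue. If it always holds, a red x y y' would give the joining
    path x1 x y y', so all triples XYY are blue. *)
Lemma orient t X Y : [disjoint X & Y] -> ~~ conn X Y -> big t <= #|X| -> big t <= #|Y| ->
  exists X' Y', [/\ X' \subset X, Y' \subset Y, #|X'| = t, #|Y'| = t
    & blue2 X' Y' \/ blue2 Y' X'].
Proof.
move=> dXY nc cX cY; pose r x y := [exists x1 in X, red x1 x y].
have [X' [Y' [b [sX sY cX' cY' H]]]] :=
  bipartite_ramsey r (leq_of_big cX) (leq_trans (double_leq_big t) cY).
have dxy x y : x \in X -> y \in Y -> x != y.
  by move=> xX yY; apply: contraTneq yY => <-; rewrite (disjointFr dXY).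
exists X', Y'; split=> //; case: b H => H.
  right=> y y' x yY' y'Y' xX' yy'; have := H x y xX' yY'; case/exists_inP=> x1 x1X h.
  have xX := subsetP sX x xX'; have [yY y'Y] := (subsetP sY y yY', subsetP sY y' y'Y').
  rewrite -blue_rot -[blue _ _ _]negbK -redNblue; last first.
    by rewrite /= !inE negb_or (dxy x y) ?(dxy x y') ?yy'.
  by apply/negP=> h'; case/negP: nc; apply/connP; exists x1, x, y, y'.
left=> x x' y xX' x'X' yY' xx'; have := H x' y x'X' yY' => /negbT h.
have yY := subsetP sY y yY'; have [xX x'X] := (subsetP sX x xX', subsetP sX x' x'X').
rewrite -[blue _ _ _]negbK -redNblue; last by rewrite /= !inE negb_or (dxy x y) ?(dxy x' y) ?xx'.
by apply: contra h => h; apply/exists_inP; exists x.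
Qed.

Definition cyclic_triple A B C :=
  [/\ [/\ rclique A, rclique B & rclique C],
      [/\ blue2 A B, blue2 B C & blue2 C A] &
      [/\ red2 A C, red2 B A & red2 C B]].

Lemma cyclic_triple_rot A B C : cyclic_triple A B C -> cyclic_triple B C A.
Proof. by case=> [[? ? ?] [? ? ?] [? ? ?]]; split; split. Qed.

(** The exceptional sets of all p in P are deleted from Q, which costs at most [2 * #|P|]
    vertices. *)
Lemma avoid_blue m P Q : [disjoint P & Q] ->
  (forall p, p \in P -> exists2 D : {set T}, #|D| <= 2 &
     forall q q', q \in Q :\: D -> q' \in Q :\: D -> ~~ blue p q q') ->
  m + 2 * #|P| <= #|Q| ->
  exists Q', [/\ Q' \subset Q, #|Q'| = m & red2 Q' P].
Proof.
move=> dPQ H cQ.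
have : exists2 D : {set T}, #|D| <= 2 * size (enum P) & forall p, p \in enum P ->
    forall q q', q \in Q :\: D -> q' \in Q :\: D -> ~~ blue p q q'.
  have : {subset enum P <= P} by move=> p; rewrite mem_enum.
  elim: (enum P) => [|p s IHs] sP; first by exists set0; rewrite ?cards0.
  have [|D cD hD] := IHs; first by move=> q qs; apply: sP; rewrite inE qs orbT.
  have [D' cD' hD'] := H p (sP p (mem_head _ _)).
  exists (D :|: D'); first by have := cardsU D D'; rewrite /=; lia.
  move=> q; rewrite inE => /predU1P[->|qs] q1 q2; rewrite setDUr => /setIP[h1 h1'] /setIP[h2 h2'].
    exact: hD'.
  exact: hD.
rewrite -cardE => -[D cD hD].
have [|Q' sQ' cQ'] := @subset_card T (Q :\: D) m.
  by have := cardsID D Q; have := subset_leq_card (subsetIr Q D); lia.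
exists Q'; split=> //; first exact: subset_trans sQ' (subsetDl _ _).
move=> q q' p qQ q'Q pP qq'; rewrite -red_rot redNblue.
  by apply: (hD p); rewrite ?mem_enum // (subsetP sQ').
have dpq r : r \in Q' -> p != r.
  move=> /(subsetP sQ'); rewrite inE => /andP[_ rQ].
  by apply: contraTneq rQ => <-; rewrite (disjointFr dPQ).
by rewrite /= !inE negb_or (dpq q) ?(dpq q') ?qq'.
Qed.

Hypothesis noF : no_fano c.

(** Each p in P is blue with pairs of R, so the dichotomy for the arrow from Q to R leaves only the
    alternative that p has few blue pairs in Q. *)
Lemma avoid_blue_oriented m P Q R : [disjoint P & Q] -> 2 <= #|R| ->
  blue2 Q R -> blue2 R P -> m + 2 * #|P| <= #|Q| ->
  exists Q', [/\ Q' \subset Q, #|Q'| = m & red2 Q' P].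
Proof.
move=> dPQ cR QR RP; apply: avoid_blue => // p pP.
have [//|noR] := link_dichotomy noF p QR.
have [|[|r [|r' [|? ?]]] [// _ us sR]] := @pickn T R set0 2; first by rewrite cards0.
have [rR r'R] : r \in R /\ r' \in R.
  by split; apply: (proj1 (andP (sR _ _))); rewrite !inE eqxx ?orbT.
have := noR r r' rR r'R; rewrite blue_rot RP //; distinct us.
Qed.

Lemma cyclic_triple_clean s A B C :
  rclique A -> rclique B -> rclique C ->
  [disjoint A & B] -> [disjoint B & C] -> [disjoint C & A] ->
  blue2 A B -> blue2 B C -> blue2 C A ->
  7 * s + 4 <= #|A| -> 7 * s + 4 <= #|B| -> 7 * s + 4 <= #|C| ->
  exists A' B' C', [/\ cyclic_triple A' B' C', A' \subset A, B' \subset B, C' \subset C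
    & [/\ #|A'| = s, #|B'| = s & #|C'| = s]].
Proof.
move=> kA kB kC dAB dBC dCA AB BC CA cA cB cC.
(* The cleaning is circular, so A is cut twice. Size 3s leaves s vertices after C' has forbidden 2s
   of them, and B must hold s vertices besides the 6s forbidden by [A1]; this explains 7s. *)
have [|A1 sA1 cA1] := @subset_card T A (3 * s); first by lia.
have [|||||B' [sB cB' BA]] := @avoid_blue_oriented s A1 B C; rewrite ?cA1 //; try lia.
- exact: disjointWl sA1 dAB.
- exact: blue2_sub (subxx C) sA1 CA.
have [|||||C' [sC cC' CB]] := @avoid_blue_oriented s B' C A; rewrite ?cB' //; try lia.
- exact: disjointWl sB dBC.
- exact: blue2_sub (subxx A) sB AB.
have [|||||A' [sA cA' AC]] := @avoid_blue_oriented s C' A1 B; rewrite ?cC' ?cA1 //; try lia.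
- exact: disjointW sC sA1 dCA.
- exact: blue2_sub sA1 (subxx B) AB.
- exact: blue2_sub (subxx B) sC BC.
have sA' := subset_trans sA sA1.
exists A', B', C'; split=> //; split; split=> //;
  try by [apply: rclique_sub; eassumption | apply: blue2_sub; eassumption].
exact: red2_sub (subxx B') sA BA.
Qed.

(** Each of the three pairs of cliques is oriented in turn at the cost of one [big]; what remains
    must suffice for the cleaning. *)
Definition triple_bound s := big (big (big (7 * s + 4))).

(** Of the eight orientations of three pairs, six are transitive and excluded. The two cyclic ones
    account for the two placements of B and C. *)
Lemma cyclic_triple_of_nonconn s X Y Z :
  rclique X -> rclique Y -> rclique Z ->
  [disjoint X & Y] -> [disjoint X & Z] -> [disjoint Y & Z] ->
  ~~ conn X Y -> ~~ conn X Z -> ~~ conn Y Z ->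
  triple_bound s <= #|X| -> triple_bound s <= #|Y| -> triple_bound s <= #|Z| ->
  exists A B C, [/\ cyclic_triple A B C, [/\ #|A| = s, #|B| = s & #|C| = s],
    A \subset X & (B \subset Y) && (C \subset Z) || (B \subset Z) && (C \subset Y)].
Proof.
rewrite /triple_bound; set t := 7 * s + 4; have t4 : 4 <= t by rewrite leq_addl.
have tE : 7 * s + 4 <= t by [].
move: t t4 tE => t t4 tE kX kY kZ dXY dXZ dYZ nXY nXZ nYZ cX cY cZ.
have [X1 [Y1 [sX1 sY1 cX1 cY1 oXY]]] := orient dXY nXY cX cY.
have dX1Z := disjointWl sX1 dXZ.
have nX1Z : ~~ conn X1 Z by apply: contra nXZ; apply: conn_sub.
have [||X2 [Z1 [sX2 sZ1 cX2 cZ1 oXZ]]] := @orient (big t) X1 Z dX1Z nX1Z; first by rewrite cX1.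
  by apply: leq_trans cZ; apply: leq_big.
have nYZ1 : ~~ conn Y1 Z1 by apply: contra nYZ; apply: conn_sub.
have [||Y2 [Z2 [sY2 sZ2 cY2 cZ2 oYZ]]] := @orient t Y1 Z1 (disjointW sY1 sZ1 dYZ) nYZ1.
- by rewrite cY1; apply: leq_big.
- by rewrite cZ1.
have [sX2' sY2' sZ2'] : [/\ X2 \subset X, Y2 \subset Y & Z2 \subset Z].
  by split; [apply: subset_trans sX2 sX1 | apply: subset_trans sY2 sY1
            | apply: subset_trans sZ2 sZ1].
have cX2' : t <= #|X2| by rewrite cX2 leq_big.
have [tX tY tZ] : [/\ 4 <= #|X2|, 4 <= #|Y2| & 4 <= #|Z2|] by rewrite cY2 cZ2 (leq_trans t4) //.
have {oXY} oXY : blue2 X2 Y2 \/ blue2 Y2 X2.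
  by case: oXY => h; [left | right]; apply: blue2_sub h.
have {oXZ} oXZ : blue2 X2 Z2 \/ blue2 Z2 X2.
  by case: oXZ => h; [left | right]; apply: blue2_sub h.
have trans P Q R : 4 <= #|P| -> 4 <= #|Q| -> 4 <= #|R| ->
    blue2 P Q -> blue2 P R -> blue2 Q R -> False.
  by move=> cP cQ cR; apply: (no_transitive noF) => //; apply: leq_trans cQ || apply: leq_trans cR.
have kX2 := rclique_sub sX2' kX; have kY2 := rclique_sub sY2' kY.
have kZ2 := rclique_sub sZ2' kZ.
have dXY2 := disjointW sX2' sY2' dXY; have dXZ2 := disjointW sX2' sZ2' dXZ.
have dYZ2 := disjointW sY2' sZ2' dYZ.
have [cY2' cZ2'] : t <= #|Y2| /\ t <= #|Z2| by rewrite cY2 cZ2.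
case: oXY oXZ oYZ => [XY|YX] [XZ|ZX] [YZ|ZY].
- by case: (trans X2 Y2 Z2).
- by case: (trans X2 Z2 Y2).
- have [|A [B [C [h sA sB sC cards]]]] :=
    cyclic_triple_clean kX2 kY2 kZ2 dXY2 dYZ2 _ XY YZ ZX (leq_trans tE cX2') (leq_trans tE cY2')
      (leq_trans tE cZ2').
    by rewrite disjoint_sym.
  exists A, B, C; split=> //; first exact: subset_trans sX2'.
  by rewrite (subset_trans sB sY2') (subset_trans sC sZ2').
- by case: (trans Z2 X2 Y2).
- by case: (trans Y2 X2 Z2).
- have [||A [B [C [h sA sB sC cards]]]] :=
    cyclic_triple_clean kX2 kZ2 kY2 dXZ2 _ _ XZ ZY YX (leq_trans tE cX2') (leq_trans tE cZ2')
      (leq_trans tE cY2').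
  + by rewrite disjoint_sym.
  + by rewrite disjoint_sym.
  exists A, B, C; split=> //; first exact: subset_trans sX2'.
  by rewrite (subset_trans sB sZ2') (subset_trans sC sY2') orbT.
- by case: (trans Y2 Z2 X2).
- by case: (trans Z2 Y2 X2).
Qed.

Definition hub_bound := big (big (big 4)).

(** If X were unjoined to all three, it would be oriented towards or from each of them, and every
    tournament on four vertices contains a transitive triple. *)
Lemma clique_meets_triple A B C X :
  blue2 A B -> blue2 B C -> blue2 C A ->
  [disjoint X & A] -> [disjoint X & B] -> [disjoint X & C] ->
  hub_bound <= #|A| -> hub_bound <= #|B| -> hub_bound <= #|C| -> hub_bound <= #|X| ->
  [|| conn X A, conn X B | conn X C].
Proof.
rewrite /hub_bound => AB BC CA dA dB dC cA cB cC cX.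
apply/negPn/negP; rewrite !negb_or => /and3P[nA nB nC].
have [X1 [A' [sX1 sA cX1 cA' oA]]] := orient dA nA cX cA.
have nB1 : ~~ conn X1 B by apply: contra nB; apply: conn_sub.
have [||X2 [B' [sX2 sB cX2 cB' oB]]] := @orient (big 4) X1 B (disjointWl sX1 dB) nB1.
- by rewrite cX1.
- by apply: leq_trans cB; apply: leq_big.
have sX2' := subset_trans sX2 sX1.
have nC2 : ~~ conn X2 C by apply: contra nC; apply: conn_sub.
have [||X3 [C' [sX3 sC cX3 cC' oC]]] := @orient 4 X2 C (disjointWl sX2' dC) nC2.
- by rewrite cX2.
- by apply: leq_trans cC; apply: leq_trans (leq_big _) (leq_big _).
have [tA tB tC] : [/\ 4 <= #|A'|, 4 <= #|B'| & 4 <= #|C'|].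
  by rewrite cA' cB' cC'; split=> //; apply: leq_trans (leq_big _) (leq_big _) || apply: leq_big.
have {oA} oA : blue2 X3 A' \/ blue2 A' X3.
  by case: oA => h; [left | right]; apply: blue2_sub h => //; apply: subset_trans sX2.
have {oB} oB : blue2 X3 B' \/ blue2 B' X3.
  by case: oB => h; [left | right]; apply: blue2_sub h.
have AB' := blue2_sub sA sB AB; have BC' := blue2_sub sB sC BC; have CA' := blue2_sub sC sA CA.
have tX : 4 <= #|X3| by rewrite cX3.
have trans P Q R : 4 <= #|P| -> 4 <= #|Q| -> 4 <= #|R| ->
    blue2 P Q -> blue2 P R -> blue2 Q R -> False.
  by move=> cP cQ cR; apply: (no_transitive noF) => //; apply: leq_trans cQ || apply: leq_trans cR.
case: oA oB oC => [XA|AX] [XB|BX] [XC|CX].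
- by case: (trans X3 A' B').
- by case: (trans X3 A' B').
- by case: (trans X3 C' A').
- by case: (trans B' C' X3).
- by case: (trans X3 B' C').
- by case: (trans C' A' X3).
- by case: (trans A' B' X3).
- by case: (trans A' B' X3).
Qed.

End Triples.

(** A blue clique on seven vertices contains a blue Fano plane, so Ramsey's theorem for k and 7 can
    only return a red clique. *)
Lemma large_red_clique (k : nat) : exists N : nat,
  forall (T : finType) (c : {set T} -> bool) (S : {set T}), no_fano c -> N <= #|S| ->
  exists A : {set T}, [/\ A \subset S, #|A| = k & rclique c A].
Proof.
have [N HN] := ramsey3 k 7; exists N => T c S noF cS.
have [[A [AS cA hA]]|[A [AS cA hA]]] := HN T c S cS.
  exists A; split=> // x y z xA yA zA us; rewrite /red us hA //; distinct us.
have [|[|x [|y [|z [|a [|b [|d [|e [|? ?]]]]]]]] [// _ us sA]] := @pickn T A set0 7.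
  by rewrite cards0 cA.
have bl p q r : uniq [:: p; q; r] -> {subset [:: p; q; r] <= [:: x; y; z; a; b; d; e]} ->
    blue c p q r.
  move=> u sub; rewrite /blue u; have inA w : w \in [:: p; q; r] -> w \in A.
    by move=> /sub/sA/andP[].
  by apply/negbT; apply: hA; (try by apply: inA; rewrite !inE eqxx ?orbT); distinct u.
exfalso; apply: (noF x y z a b d e); apply: bl.
all: try by move=> ?; rewrite !inE => /or3P[]/eqP->; rewrite eqxx ?orbT.
all: by rewrite /= !inE negb_or -andbA andbT; apply/and3P; split; distinct us.
Qed.

(** * Red tight paths with flexible ends *)

Lemma perm_uniq_sub (T : eqType) (s t : seq T) :
  uniq s -> uniq t -> {subset s <= t} -> exists r, perm_eq t (s ++ r).
Proof.
move=> us ut st; exists [seq x <- t | x \notin s].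
rewrite -(permPl (permEl (perm_filterC (mem s) t))).
rewrite perm_cat2r uniq_perm ?filter_uniq // => x; rewrite mem_filter /=.
by apply/andP/idP => [[]|xs] //; split; rewrite ?st.
Qed.

Section Tight.

Context (T : finType) (c : {set T} -> bool).
Implicit Types (x y z v : T) (s t l : seq T) (S X Y Z Q : {set T}).
Notation red := (red c).
Notation rclique := (rclique c).

Fixpoint tight s :=
  if s is x :: s' then (if s' is y :: z :: _ then red x y z else true) && tight s'
  else true.

Lemma tight_cat s x y t :
  tight (s ++ x :: y :: t) = tight (s ++ [:: x; y]) && tight (x :: y :: t).
Proof.
elim: s => [|a s IHs]; first by rewrite /=.
move: IHs; case: s => [|b [|d s]].
- by rewrite /= !andbT.
- by move=> /= ->; rewrite !andbA.
- by rewrite !cat_cons => /= ->; rewrite !andbA.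
Qed.

Lemma tight_join s x y l z z' t :
  tight (s ++ [:: x; y]) -> tight (x :: y :: l ++ [:: z; z']) -> tight (z :: z' :: t) ->
  tight (s ++ x :: y :: l ++ z :: z' :: t).
Proof.
move=> h1 h2 h3; rewrite tight_cat h1 andTb.
by have := tight_cat (x :: y :: l) z z' t; rewrite !cat_cons => ->; rewrite h3 h2.
Qed.

Lemma tight_rev s : tight (rev s) = tight s.
Proof.
elim: s => // x [|y [|z s]] IHs //.
rewrite (_ : tight [:: x, y, z & s] = red x y z && tight [:: y, z & s]) // -IHs.
rewrite !rev_cons -!cats1 -!catA /= tight_cat andbC.
by rewrite /= !andbT red_rev.
Qed.

Lemma tight_rclique s : uniq s -> rclique [set x in s] -> tight s.
Proof.
elim: s => // x s IHs us ks; apply/andP; split; last first.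
  apply: IHs; first by case/andP: us.
  by apply: rclique_sub ks; apply/subsetP=> y; rewrite !inE => ->; rewrite orbT.
move: us ks {IHs}; case: s => [|y [|z s]] // us ks.
apply: ks; rewrite ?inE ?eqxx ?orbT //.
by move: us; rewrite -[[:: x, y, z & s]]/([:: x; y; z] ++ s) cat_uniq => /andP[].
Qed.

Definition flexible s m t := forall s' t', perm_eq s' s -> perm_eq t' t ->
  tight (s' ++ m ++ t').

(* A red tight path with vertex set S that starts with the vertices of X, ends
   with those of Y, and stays tight under all reorderings of X and of Y. *)
Definition dpath S X Y := exists s m t,
  [/\ flexible s m t, uniq (s ++ m ++ t), S = [set x in s ++ m ++ t],
      X = [set x in s] & Y = [set x in t]].

Lemma dpath_sub S X Y : dpath S X Y -> X \subset S /\ Y \subset S.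
Proof.
case=> s [m [t [_ _ -> -> ->]]].
by split; apply/subsetP=> x; rewrite !inE !mem_cat => ->; rewrite ?orbT.
Qed.

Lemma dpath_sym S X Y : dpath S X Y -> dpath S Y X.
Proof.
case=> s [m [t [h u -> -> ->]]]; exists t, (rev m), s; split=> //.
- move=> t' s' tt' ss'; rewrite -tight_rev !rev_cat revK -catA; apply: h; by rewrite perm_rev.
- by rewrite -rev_uniq !rev_cat revK -catA -(perm_uniq (s1 := s ++ m ++ t)) //;
    rewrite perm_cat ?perm_cat // perm_sym perm_rev.
- by apply/setP=> x; rewrite !inE !mem_cat mem_rev; do !case: (x \in _).
Qed.

Lemma dpath_tight S X Y : dpath S X Y -> exists s, [/\ uniq s, tight s & size s = #|S|].
Proof.
case=> s [m [t [h u -> _ _]]]; exists (s ++ m ++ t); split; rewrite ?h //.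
by rewrite cardsE (card_uniqP u).
Qed.

Lemma dpath_rclique Q X Y : rclique Q -> [disjoint X & Y] -> Q = X :|: Y -> dpath Q X Y.
Proof.
move=> kQ dXY EQ; exists (enum X), [::], (enum Y).
have u : uniq (enum X ++ enum Y).
  rewrite cat_uniq !enum_uniq andbT /=; apply/hasPn=> x; rewrite !mem_enum => xY.
  by rewrite (disjointFl dXY).
have sQ : [set x in enum X ++ enum Y] = Q.
  by apply/setP=> x; rewrite EQ !inE mem_cat !mem_enum.
split; rewrite ?cat0s //; try by [rewrite sQ | apply/setP=> x; rewrite inE mem_enum].
move=> s t sX tY /=; have p : perm_eq (s ++ t) (enum X ++ enum Y) by rewrite perm_cat.
apply: tight_rclique; first by rewrite (perm_uniq p).
by apply: rclique_sub kQ; rewrite -sQ; apply/subsetP=> x; rewrite !inE (perm_mem p).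
Qed.

(** The end Y1 is reordered to finish with x, x' and X2 to begin with y', y. The other vertices of
    these two ends become part of the rigid middle, while the outer ends stay flexible. *)
Lemma dpath_merge S1 X1 Y1 S2 X2 Y2 x x' l y' y :
  dpath S1 X1 Y1 -> dpath S2 X2 Y2 -> [disjoint S1 & S2] ->
  x \in Y1 -> x' \in Y1 -> x != x' -> y' \in X2 -> y \in X2 -> y' != y ->
  uniq l -> (forall z, z \in l -> z \notin S1 :|: S2) ->
  tight (x :: x' :: l ++ [:: y'; y]) ->
  dpath (S1 :|: S2 :|: [set z in l]) X1 Y2.
Proof.
case=> s1 [m1 [t1 [h1 u1 ES1 -> EY1]]] [s2 [m2 [t2 [h2 u2 ES2 EX2 ->]]]] dS.
rewrite {}EY1 {}EX2 !inE => xt x't xx' y's ys yy' ul lS hl.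
have [r1 p1] : exists r, perm_eq t1 ([:: x; x'] ++ r).
  apply: perm_uniq_sub; rewrite /= ?inE ?xx' //; last by move=> z; rewrite !inE => /orP[]/eqP->.
  by move: u1; rewrite !cat_uniq => /and5P[].
have [r2 p2] : exists r, perm_eq s2 ([:: y'; y] ++ r).
  apply: perm_uniq_sub; rewrite /= ?inE ?yy' //; last by move=> z; rewrite !inE => /orP[]/eqP->.
  by move: u2; rewrite cat_uniq => /and3P[].
pose m := m1 ++ r1 ++ [:: x; x'] ++ l ++ [:: y'; y] ++ r2 ++ m2.
have pm : perm_eq (s1 ++ m ++ t2) ((s1 ++ m1 ++ t1) ++ l ++ (s2 ++ m2 ++ t2)).
  apply/permP=> p; move/permP/(_ p): p1; move/permP/(_ p): p2.
  by rewrite /m !count_cat => -> ->; clear; lia.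
have S1E z : (z \in s1 ++ m1 ++ t1) = (z \in S1) by rewrite ES1 inE.
have S2E z : (z \in s2 ++ m2 ++ t2) = (z \in S2) by rewrite ES2 inE.
exists s1, m, t2; split=> //.
- move=> s' t' ps pt; rewrite /m -!catA /=.
  have H1 : tight (s' ++ m1 ++ r1 ++ [:: x; x']).
    by apply: h1 ps _; rewrite perm_sym (perm_trans p1) // perm_catC.
  have H2 : tight ((y' :: y :: r2) ++ m2 ++ t') by apply: h2 _ pt; rewrite perm_sym.
  have := @tight_join (s' ++ m1 ++ r1) x x' l y' y (r2 ++ m2 ++ t').
  by rewrite -!catA; apply.
- rewrite (perm_uniq pm) cat_uniq u1 cat_uniq ul u2 !andbT /=; apply/andP; split.
    apply/hasPn=> z; rewrite mem_cat S2E /= S1E.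
    by case/orP=> [/lS|zS2]; [rewrite inE negb_or => /andP[] | rewrite (disjointFl dS)].
  apply/hasPn=> z; rewrite S2E => zS2; apply/negP=> /= /lS.
  by rewrite inE zS2 orbT.
- apply/setP=> z; rewrite !inE (perm_mem pm) mem_cat S1E mem_cat S2E.
  by rewrite [(z \in l) || _]orbC orbA.
Qed.

(** The end is reordered to begin with a, b, d, e, and v goes between b and d. Only the three
    assumed triples contain v. The four vertices become rigid, which is the price of one
    insertion. *)
Lemma dpath_absorb S X Y v a b d e :
  dpath S X Y -> v \notin S -> uniq [:: a; b; d; e] ->
  {subset [:: a; b; d; e] <= Y} ->
  red a b v -> red b v d -> red v d e ->
  exists2 Y' : {set T}, Y' \subset Y /\ #|Y'| + 4 = #|Y| & dpath (v |: S) X Y'.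
Proof.
case=> s [m [t [h u ES -> ->]]] vS uq sq r1 r2 r3.
have ut : uniq t by move: u; rewrite !cat_uniq => /and5P[].
have [r p] : exists r, perm_eq t ([:: a; b; d; e] ++ r).
  by apply: perm_uniq_sub => // z /sq; rewrite inE.
have sr : {subset r <= t} by move=> z zr; rewrite (perm_mem p) mem_cat zr orbT.
exists [set z in r].
  split; first by apply/subsetP=> z; rewrite !inE => /sr.
  rewrite !cardsE (card_uniqP ut) (perm_size p) size_cat addnC.
  by rewrite (card_uniqP _) //; move: ut; rewrite (perm_uniq p) cat_uniq => /and3P[].
have pm : perm_eq (s ++ (m ++ [:: a; b; v; d; e]) ++ r) (v :: s ++ m ++ t).
  apply/permP=> q; move/permP/(_ q): p; rewrite !count_cat /= !count_cat => ->.
  by clear; lia.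
exists s, (m ++ [:: a; b; v; d; e]), r; split=> //.
- move=> s' r' ps pr; have H : tight (s' ++ m ++ [:: a, b, d, e & r']).
    by apply: h ps _; rewrite perm_sym (perm_trans p) // (perm_cat2l [:: a; b; d; e]) perm_sym.
  have := @tight_join (s' ++ m) a b [:: v] d e r'; rewrite -!catA /=; apply.
  + by move: H; rewrite catA tight_cat -catA => /andP[].
  + by rewrite r1 r2 r3.
  + by move: H; rewrite -(cat_rcons) cat_rcons catA (tight_cat (s' ++ m)) => /andP[_] /and3P[].
- by rewrite (perm_uniq pm) cons_uniq u; move: vS; rewrite ES inE => ->.
- by apply/setP=> z; rewrite inE (perm_mem pm) ES !inE.
Qed.

End Tight.

(** * Cyclic triples without bridges *)

Ltac split_and := repeat match goal with |- is_true (_ && _) => apply/andP; split end.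

Ltac side := solve [done | by rewrite eq_sym].
Ltac red_by H :=
  solve [apply: H; side | rewrite red_rot; apply: H; side | rewrite -red_rot; apply: H; side].
Ltac blue_by H :=
  solve [apply: H; side | rewrite blue_rot; apply: H; side | rewrite -blue_rot; apply: H; side].

Section Exact.

Context (T : finType) (c : {set T} -> bool).
Implicit Types (x y z v w : T) (s t l : seq T) (A B C D X Y Z : {set T}).
Notation red := (red c).
Notation blue := (blue c).
Notation rclique := (rclique c).
Notation blue2 := (blue2 c).
Notation red2 := (red2 c).
Notation tight := (tight c).
Notation cyclic_triple := (cyclic_triple c).

(** In contrast to [conn], the tight path may pass through a few arbitrary vertices between its end
    pairs. *)
Definition bridge A B := exists x x' m y' y,
  [/\ [/\ x \in A, x' \in A, y' \in B & y \in B],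
      tight (x :: x' :: m ++ [:: y'; y]), uniq (x :: x' :: m ++ [:: y'; y])
    & size m <= 3].

Definition red_path (n : nat) := exists s, [/\ uniq s, tight s & n <= size s].

(** A common vertex would make a degenerate triple blue. *)
Lemma blue2_disjoint A B : 2 <= #|A| -> blue2 A B -> [disjoint A & B].
Proof.
move=> cA AB; apply/pred0P=> x /=; apply/negbTE/negP=> /andP[xA xB].
have [|[|y [|? ?]] [// _ _ /(_ y)]] := @pickn T A [set x] 1; first by rewrite cards1.
rewrite !inE eqxx => /(_ isT)/andP[yA yx].
by have := AB x y x xA yA xB; rewrite eq_sym yx => /(_ isT)/andP[/=]; rewrite !inE eqxx orbT.
Qed.

(* With respect to the triple, v is coloured like a vertex of A. *)
Definition alike A B C v := exists2 D : {set T}, #|D| <= 5 &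
  [/\ forall a b, a \in A :\: D -> b \in B :\: D -> blue v a b,
      forall b d, b \in B :\: D -> d \in C :\: D -> blue v b d &
      forall d d', d \in C :\: D -> d' \in C :\: D -> d != d' -> blue v d d'].

Hypothesis noF : no_fano c.

Lemma redE x y z : x != y -> x != z -> y != z -> red x y z = ~~ blue x y z.
Proof. by move=> xy xz yz; rewrite redNblue //= !inE negb_or xy xz yz. Qed.

Lemma pick1 X D : #|D| < #|X| -> exists2 x, x \in X & x \notin D.
Proof.
move=> h; have [|[|x [|? ?]] [// _ _ /(_ x)]] := @pickn T X D 1; first by rewrite add1n.
by rewrite inE eqxx => /(_ isT)/andP[]; exists x.
Qed.

Section FixedTriple.

Variables A B C : {set T}.
Hypothesis ABC : cyclic_triple A B C.
Hypotheses (cA : 30 <= #|A|) (cB : 30 <= #|B|) (cC : 30 <= #|C|).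
Hypotheses (nAB : ~ bridge A B) (nBC : ~ bridge B C) (nCA : ~ bridge C A).

Let AB_neq a b : a \in A -> b \in B -> a != b.
Proof.
case: ABC => [_ [h _ _] _] aA; apply: contraTneq => <-.
by rewrite (disjointFr (blue2_disjoint _ h)) //; lia.
Qed.

Let BC_neq b d : b \in B -> d \in C -> b != d.
Proof.
case: ABC => [_ [_ h _] _] bB; apply: contraTneq => <-.
by rewrite (disjointFr (blue2_disjoint _ h)) //; lia.
Qed.

Let CA_neq d a : d \in C -> a \in A -> d != a.
Proof.
case: ABC => [_ [_ _ h] _] dC; apply: contraTneq => <-.
by rewrite (disjointFr (blue2_disjoint _ h)) //; lia.
Qed.

(** If d a b were red, p x d a b b' would be a bridge from A to B: p x d and x d a are of the red
    type AAC, and a b b' is of the red type BBA. *)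
Lemma transversal_blue a b d : a \in A -> b \in B -> d \in C -> blue d a b.
Proof.
move=> aA bB dC; have [[kA kB kC] [AB BC CA] [AC BA CB]] := ABC.
rewrite -[blue _ _ _]negbK -redE;
  [|exact: CA_neq | by rewrite eq_sym BC_neq | exact: AB_neq].
apply/negP=> dab; apply: nAB.
have [|p pA] := @pick1 A [set a]; first by rewrite cards1; lia.
rewrite inE => pa.
have [|x xA] := @pick1 A [set a; p]; first by rewrite cards2; lia.
rewrite !inE negb_or => /andP[xa xp].
have [|b' b'B] := @pick1 B [set b]; first by rewrite cards1; lia.
rewrite inE => b'b.
exists p, x, [:: d; a], b, b'; split=> //.
- rewrite /= dab !andbT; split_and; first [done | red_by AC | red_by BA].
- rewrite /= !inE !negb_or; split_and; first [side | exact: AB_neq | exact: BC_neq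
    | exact: CA_neq | by rewrite eq_sym; first [exact: AB_neq | exact: BC_neq | exact: CA_neq]].
Qed.

(** Red triples of v with pairs of A and with pairs of B are available, so every wrong colour yields
    a bridge or a blue Fano plane. A red v a b gives the bridge p x v a b b', a red v b d gives the
    bridge p x v b d d' from B to C, and, since v a d is shown to be red, a red v d d' gives the
    bridge d d' v a a' from C to A. *)
Lemma alike_near v (DA DB : {set T}) :
  v \notin A -> v \notin B -> v \notin C -> #|DA| <= 2 -> #|DB| <= 2 ->
  (forall a a', a \in A :\: DA -> a' \in A :\: DA -> ~~ blue v a a') ->
  (forall b b', b \in B :\: DB -> b' \in B :\: DB -> ~~ blue v b b') ->
  alike A B C v.
Proof.
move=> vA vB vC cDA cDB nA nB; have [[kA kB kC] [AB BC CA] [AC BA CB]] := ABC.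
have vneq (Z : {set T}) z : v \notin Z -> z \in Z -> v != z.
  by move=> vZ; apply: contraTneq => <-.
have redA a a' : a \in A :\: DA -> a' \in A :\: DA -> a != a' -> red v a a'.
  move=> h h' aa'; rewrite redE ?nA //; first by apply: vneq vA _; case/setDP: h.
  by apply: vneq vA _; case/setDP: h'.
have redB b b' : b \in B :\: DB -> b' \in B :\: DB -> b != b' -> red v b b'.
  move=> h h' bb'; rewrite redE ?nB //; first by apply: vneq vB _; case/setDP: h.
  by apply: vneq vB _; case/setDP: h'.
have pick2 (Z D : {set T}) z : 30 <= #|Z| -> #|D| <= 2 ->
    exists p q, [/\ p \in Z :\: D, q \in Z :\: D, p != q, p != z & q != z].
  move=> cZ cD; have [|[|p [|q [|? ?]]] [// _ us h]] := @pickn T Z (z |: D) 2.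
    by rewrite cardsU1; case: (z \notin D); lia.
  move: us; rewrite /= !inE andbT => pq; exists p, q.
  have /andP[pZ] := h p (mem_head _ _); have /andP[qZ] := h q (mem_last p [:: q]).
  by rewrite !inE !negb_or => /andP[qz qD] /andP[pz pD]; rewrite pZ qZ pD qD.
have c0 : #|@set0 T| <= 2 by rewrite cards0.
have blAB a b : a \in A :\: DA -> b \in B -> blue v a b.
  move=> aA' bB; have aA : a \in A by case/setDP: aA'.
  rewrite -[blue _ _ _]negbK -redE; [|exact: vneq vA aA|exact: vneq vB bB|exact: AB_neq].
  apply/negP=> vab; apply: nAB.
  have [p [x [pA' xA' px pa xa]]] := pick2 A DA a cA cDA.
  have [b' [_ [/setDP[b'B _] _ _ b'b _]]] := pick2 B set0 b cB c0.
  have [pA xA] : p \in A /\ x \in A by split; [case/setDP: pA' | case/setDP: xA'].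
  exists p, x, [:: v; a], b, b'; split=> //.
  - by rewrite /= vab !andbT; split_and; first [done | red_by redA | red_by BA].
  - rewrite /= !inE !negb_or; split_and; first [side | exact: AB_neq | exact: (vneq B)
      | exact: (vneq A) | by rewrite eq_sym; exact: (vneq A)].
have blBC b d : b \in B :\: DB -> d \in C -> blue v b d.
  move=> bB' dC; have bB : b \in B by case/setDP: bB'.
  rewrite -[blue _ _ _]negbK -redE; [|exact: vneq vB bB|exact: vneq vC dC|exact: BC_neq].
  apply/negP=> vbd; apply: nBC.
  have [p [x [pB' xB' px pb xb]]] := pick2 B DB b cB cDB.
  have [d' [_ [/setDP[d'C _] _ _ d'd _]]] := pick2 C set0 d cC c0.
  have [pB xB] : p \in B /\ x \in B by split; [case/setDP: pB' | case/setDP: xB'].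
  exists p, x, [:: v; b], d, d'; split=> //.
  - by rewrite /= vbd !andbT; split_and; first [done | red_by redB | red_by CB].
  - rewrite /= !inE !negb_or; split_and; first [side | exact: BC_neq | exact: (vneq B)
      | exact: (vneq C) | by rewrite eq_sym; exact: (vneq B)].
have redAC a d : a \in A -> d \in C -> red v a d.
  move=> aA dC; rewrite redE; [|exact: vneq vA aA|exact: vneq vC dC|by rewrite eq_sym CA_neq].
  apply/negP=> vad.
  have [a' [_ [a'A' _ _ a'a _]]] := pick2 A DA a cA cDA.
  have [b [_ [/setDP[bB _] _ _ _ _]]] := pick2 B set0 v cB c0.
  have [b' [_ [b'B' _ _ b'b _]]] := pick2 B DB b cB cDB.
  have [d' [_ [/setDP[d'C _] _ _ d'd _]]] := pick2 C set0 d cC c0.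
  have [a'A b'B] : a' \in A /\ b' \in B by split; [case/setDP: a'A' | case/setDP: b'B'].
  (* If v a d were blue, the line v, a', b and the points a, d, b', d' would span a blue plane:
     beyond the triples at v, its lines are of types AAB, CCA, ABC and BBC. *)
  apply: (noF (x := v) (y := a') (z := b) (a := a) (b := d) (d := b') (e := d')) => //.
  - exact: blAB.
  - exact: blBC.
  - blue_by AB.
  - blue_by CA.
  - by rewrite blue_swap -blue_rot transversal_blue.
  - blue_by BC.
exists (DA :|: DB); first by have := cardsU DA DB; lia.
have inU (Z D D' : {set T}) z : z \in Z :\: (D :|: D') -> z \in Z :\: D /\ z \in Z :\: D'.
  by rewrite setDUr inE => /andP[].
split.
- by move=> a b /inU[h _] /setDP[h' _]; apply: blAB.
- by move=> b d /inU[_ h] /setDP[h' _]; apply: blBC.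
move=> d d' /setDP[dC _] /setDP[d'C _] dd'.
rewrite -[blue _ _ _]negbK -redE //; [|exact: vneq vC dC|exact: vneq vC d'C].
apply/negP=> vdd; apply: nCA.
have [a [a' [aA' a'A' aa' _ _]]] := pick2 A DA v cA cDA.
have [aA a'A] : a \in A /\ a' \in A by split; [case/setDP: aA' | case/setDP: a'A'].
have vad' := redAC a d' aA d'C.
exists d, d', [:: v], a, a'; split=> //.
- rewrite /= -red_rot vdd /= andbT; split_and.
    by rewrite red_rot.
  exact: redA.
- rewrite /= !inE !negb_or; split_and; first [side | exact: CA_neq | exact: (vneq A)
    | by rewrite eq_sym; exact: (vneq C)].
Qed.

Lemma alike_mem v : v \in A -> alike A B C v.
Proof.
move=> vA; have [[kA kB kC] [AB BC CA] [AC BA CB]] := ABC.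
exists [set v]; rewrite ?cards1 //; split.
- move=> a b /setDP[aA]; rewrite inE => av /setDP[bB _]; blue_by AB.
- by move=> b d /setDP[bB _] /setDP[dC _]; rewrite blue_rot blue_rot transversal_blue.
- move=> d d' /setDP[dC _] /setDP[d'C _] dd'; blue_by CA.
Qed.

End FixedTriple.

(** By the dichotomy for each of the three arrows, v is [near] one clique of every pair, hence
    [near] at least two of the three. *)
Lemma alike_any A B C v : cyclic_triple A B C ->
  30 <= #|A| -> 30 <= #|B| -> 30 <= #|C| ->
  ~ bridge A B -> ~ bridge B C -> ~ bridge C A ->
  [\/ alike A B C v, alike B C A v | alike C A B v].
Proof.
move=> ABC cA cB cC nAB nBC nCA; have BCA := cyclic_triple_rot ABC.
have CAB := cyclic_triple_rot BCA.
have [vA|vA] := boolP (v \in A); first by apply: Or31; apply: alike_mem.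
have [vB|vB] := boolP (v \in B); first by apply: Or32; apply: alike_mem.
have [vC|vC] := boolP (v \in C); first by apply: Or33; apply: alike_mem.
have [_ [AB BC CA] _] := ABC.
pose near X := exists2 D : {set T}, #|D| <= 2 &
  forall x x', x \in X :\: D -> x' \in X :\: D -> ~~ blue v x x'.
have dich X Y : blue2 X Y -> near X \/ near Y.
  move=> XY; have [?|h] := link_dichotomy noF v XY; [by left | right].
  by exists set0; rewrite ?cards0 // => y y'; rewrite !setD0; apply: h.
have AB' : near A -> near B -> alike A B C v.
  by case=> DA cDA hA [DB cDB hB]; apply: (@alike_near _ _ _ ABC _ _ _ _ _ _ v DA DB).
have BC' : near B -> near C -> alike B C A v.
  by case=> DA cDA hA [DB cDB hB]; apply: (@alike_near _ _ _ BCA _ _ _ _ _ _ v DA DB).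
have CA' : near C -> near A -> alike C A B v.
  by case=> DA cDA hA [DB cDB hB]; apply: (@alike_near _ _ _ CAB _ _ _ _ _ _ v DA DB).
by case: (dich _ _ AB) (dich _ _ BC) (dich _ _ CA) => h1 [] h2 [] h3;
  by [apply: Or31; auto | apply: Or32; auto | apply: Or33; auto].
Qed.

(* A blue triple x y w would extend to a blue Fano plane whose other four points
   are three vertices of C and one of B. *)
Lemma alike_red3 A B C x y w : 20 <= #|B| -> 20 <= #|C| ->
  alike A B C x -> alike A B C y -> alike A B C w -> uniq [:: x; y; w] -> red x y w.
Proof.
move=> cB cC [Dx cDx [_ xBC xCC]] [Dy cDy [_ yBC yCC]] [Dw cDw [_ wBC wCC]] us.
rewrite redNblue //; apply/negP=> xyw.
pose D := Dx :|: Dy :|: Dw.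
have cD : #|D| <= 15 by have := cardsU (Dx :|: Dy) Dw; have := cardsU Dx Dy; rewrite -/D; lia.
have [|[|d1 [|d2 [|d3 [|? ?]]]] [// _ ud dC]] := @pickn T C D 3; first by lia.
have [|b bB bD] := @pick1 B D; first by lia.
have sD Z z : z \in Z -> z \notin D -> [/\ z \in Z :\: Dx, z \in Z :\: Dy & z \in Z :\: Dw].
  by move=> zZ; rewrite !inE !negb_or zZ -andbA => /and3P[-> -> ->].
have [bx by_ bw] := sD B b bB bD.
have dD d : d \in [:: d1; d2; d3] -> [/\ d \in C :\: Dx, d \in C :\: Dy & d \in C :\: Dw].
  by move=> /dC/andP[]; apply: sD.
have [m1 m2 m3] : [/\ d1 \in [:: d1; d2; d3], d2 \in [:: d1; d2; d3] & d3 \in [:: d1; d2; d3]].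
  by rewrite !inE !eqxx !orbT.
have [d1x d1y d1w] := dD _ m1; have [d2x d2y d2w] := dD _ m2; have [d3x d3y d3w] := dD _ m3.
have [n12 n13 n23] : [/\ d1 != d2, d1 != d3 & d2 != d3] by split; distinct ud.
by apply: (noF (e := b) xyw (xCC _ _ d1x d2x n12) _ (yCC _ _ d1y d3y n13) _ _
  (wCC _ _ d2w d3w n23));
  rewrite blue_rot blue_swap -blue_rot; [apply: xBC | apply: yBC | apply: wBC].
Qed.

(* Here the other four points are one vertex of A, two of B and one of C. *)
Lemma alike_red2 A B C x y z : 20 <= #|A| -> 20 <= #|B| -> 20 <= #|C| ->
  alike A B C x -> alike A B C y -> alike C A B z -> uniq [:: x; y; z] -> red x y z.
Proof.
move=> cA cB cC [Dx cDx [xAB xBC xCC]] [Dy cDy [yAB yBC yCC]] [Dz cDz [zCA zAB zBB]] us.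
rewrite redNblue //; apply/negP=> xyz.
pose D := Dx :|: Dy :|: Dz.
have cD : #|D| <= 15 by have := cardsU (Dx :|: Dy) Dz; have := cardsU Dx Dy; rewrite -/D; lia.
have [|[|b1 [|b2 [|? ?]]] [// _ ub bB]] := @pickn T B D 2; first by lia.
have [|a aA aD] := @pick1 A D; first by lia.
have [|d dC dD] := @pick1 C D; first by lia.
have sD Z w : w \in Z -> w \notin D -> [/\ w \in Z :\: Dx, w \in Z :\: Dy & w \in Z :\: Dz].
  by move=> wZ; rewrite !inE !negb_or wZ -andbA => /and3P[-> -> ->].
have [m1 m2] : b1 \in [:: b1; b2] /\ b2 \in [:: b1; b2] by rewrite !inE !eqxx !orbT.
have [ax ay az] := sD A a aA aD; have [dx dy dz] := sD C d dC dD.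
have /andP[/(sD B b1) h1 /h1[b1x b1y b1z]] := bB b1 m1.
have /andP[/(sD B b2) h2 /h2[b2x b2y b2z]] := bB b2 m2.
have n12 : b1 != b2 by distinct ub.
apply: (noF xyz (xAB a b1 ax b1x) (xBC b2 d b2x dx) (yAB a b2 ay b2y) (yBC b1 d b1y dy) _
  (zBB b1 b2 b1z b2z n12)).
by rewrite blue_rot blue_swap -blue_rot zCA.
Qed.

(** * Zigzag paths and the extremal structure *)

Fixpoint zigzag s t :=
  if s is z :: s' then
    if t is x :: y :: t' then [:: z, x, y & zigzag s' t'] else z :: t
  else t.

(** Between k vertices of s there are k - 1 gaps, each filled by two vertices of t. Under this
    bound, t can drop below two vertices only at the last vertex of s, so the branch [z :: t]
    discards nothing. *)
Lemma perm_zigzag s t : 2 * size s <= size t + 2 -> perm_eq (zigzag s t) (s ++ t).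
Proof.
elim: s t => [|z s IHs] [|x [|y t]] //=; try by case: s {IHs} => //= *; lia.
move=> h; rewrite perm_cons; rewrite perm_sym (perm_catCA s [:: x; y] t) /= !perm_cons perm_sym.
by apply: IHs; lia.
Qed.

Lemma tight_zigzag X Z p q s t : rclique X -> red2 X Z ->
  {subset s <= Z} -> {subset p :: q :: t <= X} -> uniq (p :: q :: t) ->
  tight (p :: q :: zigzag s t).
Proof.
move=> kX XZ; elim: s t p q => [|z s IHs] t p q sZ tX us.
  by apply: tight_rclique => //; apply: rclique_sub kX; apply/subsetP=> x; rewrite inE => /tX.
have zZ : z \in Z by apply: sZ; rewrite inE eqxx.
have [pX qX] : p \in X /\ q \in X by split; apply: tX; rewrite !inE eqxx ?orbT.
have pq : p != q by distinct us.
case: t us tX => [|x [|y t]] us tX.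
- by rewrite /= !andbT XZ.
- have xX : x \in X by apply: tX; rewrite !inE eqxx ?orbT.
  have qx : q != x by distinct us.
  by rewrite /= andbT; apply/andP; split; red_by XZ.
have [xX yX] : x \in X /\ y \in X by split; apply: tX; rewrite !inE eqxx ?orbT.
have [qx xy] : q != x /\ x != y by split; distinct us.
have h : tight [:: x, y & zigzag s t].
  apply: IHs => [w ws|w wt|]; first by apply: sZ; rewrite inE ws orbT.
    by apply: tX; rewrite !inE in wt *; rewrite wt !orbT.
  by move: us => /= /and3P[].
change (red p q z && (red q z x && (red z x y && tight [:: x, y & zigzag s t]))).
by rewrite h andbT; apply/and3P; split; red_by XZ.
Qed.

(* The pattern z x x z x x ... *)
Lemma red_path_zigzag X Z k : rclique X -> red2 X Z -> [disjoint X & Z] ->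
  k <= #|Z| -> 2 * k <= #|X| + 2 -> red_path (#|X| + k).
Proof.
move=> kX XZ dXZ kZ kX2; pose s := take k (enum Z).
have ss : size s = k by rewrite size_take -cardE; case: ltnP => //; lia.
have sZ : {subset s <= Z} by move=> z /mem_take; rewrite mem_enum.
have pm : perm_eq (zigzag s (enum X)) (s ++ enum X) by apply: perm_zigzag; rewrite ss -cardE.
exists (zigzag s (enum X)); split; last by rewrite (perm_size pm) size_cat ss -cardE addnC.
  rewrite (perm_uniq pm) cat_uniq take_uniq ?enum_uniq //= andbT.
  by apply/hasPn=> x; rewrite mem_enum => xX; apply/negP=> /sZ; rewrite (disjointFr dXZ).
have : {subset enum X <= X} by move=> x; rewrite mem_enum.
have := enum_uniq X; case: s sZ {ss pm} => [|z s] sZ; case: (enum X) => [|x [|y t]] //= us tX.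
  apply: (@tight_rclique _ _ [:: x, y & t]) => //.
  by apply: rclique_sub kX; apply/subsetP=> w; rewrite inE => /tX.
have zZ : z \in Z by apply: sZ; rewrite inE eqxx.
have [xX yX] : x \in X /\ y \in X by split; apply: tX; rewrite !inE eqxx ?orbT.
have xy : x != y by distinct us.
apply/andP; split; first by red_by XZ.
by apply: (tight_zigzag kX XZ) => // w ws; apply: sZ; rewrite inE ws orbT.
Qed.

Lemma red_path_leq m n : m <= n -> red_path n -> red_path m.
Proof. by move=> mn [s [us ts ns]]; exists s; split=> //; apply: leq_trans ns. Qed.

Lemma exact_red_path n A B C : #|T| = 2 * n - 1 -> cyclic_triple A B C ->
  30 <= #|A| -> 30 <= #|B| -> 30 <= #|C| ->
  ~ bridge A B -> ~ bridge B C -> ~ bridge C A -> red_path n.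
Proof.
move=> cT ABC cA cB cC nAB nBC nCA.
pose P v (i : nat) := [\/ i = 0 /\ alike A B C v, i = 1 /\ alike B C A v
  | i = 2 /\ alike C A B v].
have [f fP] : exists f : T -> nat, forall v, P v (f v).
  apply: fin_all_exists => v.
  have [h|h|h] := alike_any v ABC cA cB cC nAB nBC nCA.
  - by exists 0; apply: Or31.
  - by exists 1; apply: Or32.
  - by exists 2; apply: Or33.
pose V (i : nat) := [set v | f v == i].
have V0 v : v \in V 0 -> alike A B C v by rewrite inE => /eqP E; case: (fP v); rewrite E => -[].
have V1 v : v \in V 1 -> alike B C A v by rewrite inE => /eqP E; case: (fP v); rewrite E => -[].
have V2 v : v \in V 2 -> alike C A B v by rewrite inE => /eqP E; case: (fP v); rewrite E => -[].
have dV i j : i != j -> [disjoint V i & V j].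
  by move=> ij; apply/pred0P=> v /=; rewrite !inE; case: eqP => // ->; apply: negbTE.
have sum : #|V 0| + #|V 1| + #|V 2| = 2 * n - 1.
  rewrite -cT -cardsT; have E : V 0 :|: V 1 :|: V 2 = setT.
    by apply/setP=> v; rewrite !inE; case: (fP v) => -[->].
  rewrite -E !cardsU (disjoint_setI0 (dV 0 1 isT)).
  rewrite setIUl (disjoint_setI0 (dV 0 2 isT)) (disjoint_setI0 (dV 1 2 isT)).
  by rewrite setU0 !cards0 !subn0.
have neqV (i j : nat) x y : i != j -> x \in V i -> y \in V j -> x != y.
  by move=> ij xi; apply: contraTneq => <-; rewrite (disjointFr (dV _ _ ij)).
have [sA sB sC] : [/\ 20 <= #|A|, 20 <= #|B| & 20 <= #|C|] by split; lia.
have k0 : rclique (V 0).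
  by move=> x y z /V0 ? /V0 ? /V0 ?; apply: (@alike_red3 A B C).
have k1 : rclique (V 1).
  by move=> x y z /V1 ? /V1 ? /V1 ?; apply: (@alike_red3 B C A).
have k2 : rclique (V 2).
  by move=> x y z /V2 ? /V2 ? /V2 ?; apply: (@alike_red3 C A B).
have u3 i j x y z : i != j -> x \in V i -> y \in V i -> z \in V j -> x != y ->
    uniq [:: x; y; z].
  by move=> ij xi yi zj xy; rewrite /= !inE negb_or xy !(neqV i j).
have r02 : red2 (V 0) (V 2).
  move=> x y z xV yV zV xy; apply: (@alike_red2 A B C); auto.
  by apply: (u3 0 2).
have r10 : red2 (V 1) (V 0).
  move=> x y z xV yV zV xy; apply: (@alike_red2 B C A); auto.
  by apply: (u3 1 0).
have r21 : red2 (V 2) (V 1).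
  move=> x y z xV yV zV xy; apply: (@alike_red2 C A B); auto.
  by apply: (u3 2 1).
have path0 k := @red_path_zigzag _ _ k k0 r02 (dV 0 2 isT).
have path1 k := @red_path_zigzag _ _ k k1 r10 (dV 1 0 isT).
have path2 k := @red_path_zigzag _ _ k k2 r21 (dV 2 1 isT).
set a := #|V 0| in sum path0 path1 path2 *; set b := #|V 1| in sum path0 path1 path2 *.
set d := #|V 2| in sum path0 path1 path2 *.
pose k i j := minn j ((i + 2) %/ 2).
(* If a minimum is attained by the size of the other class, for instance [k a d = d], then either a
   + d >= n or b >= n. Otherwise each length is at least (3i + 1) / 2 for its class size i, and
   these sum to (3 (2n - 1) + 3) / 2 = 3n; the bound is tight. *)
have : [|| n <= a + k a d, n <= b + k b a | n <= d + k d b].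
  rewrite /k; lia.
case/or3P=> h; [apply: red_path_leq h (path0 _ _ _) | apply: red_path_leq h (path1 _ _ _)
  | apply: red_path_leq h (path2 _ _ _)]; rewrite /k; lia.
Qed.

End Exact.

(** * Merging paths through hubs *)

Section Hubs.

Context (T : finType) (c : {set T} -> bool).
Implicit Types (x y z v w : T) (s t l m : seq T) (A B C D E H S X Y Z U W : {set T}).
Notation red := (red c).
Notation blue := (blue c).
Notation rclique := (rclique c).
Notation blue2 := (blue2 c).
Notation tight := (tight c).
Notation conn := (conn c).
Notation dpath := (dpath c).
Notation red_path := (red_path c).

Lemma leq_cardD A D : #|A| <= #|A :\: D| + #|D|.
Proof. by have := cardsID D A; have := subset_leq_card (subsetIr A D); lia. Qed.

Lemma leq_cardD2 A x y : #|A| <= #|A :\: [set x; y]| + 2.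
Proof.
by apply: leq_trans (leq_cardD A [set x; y]) _; rewrite leq_add2l cards2; case: (_ == _).
Qed.

Lemma red_neq x y z : red x y z -> [/\ x != y, x != z & y != z].
Proof. by case/andP; rewrite /= !inE negb_or => /and3P[/andP[-> ->] ->]. Qed.

Lemma set_nil : [set z in [::]] = set0 :> {set T}.
Proof. by apply/setP=> z; rewrite !inE. Qed.

(** Robust joining: it survives when earlier merges have used up to d vertices of the hub. *)
Definition attached d Y H := forall D, #|D| <= d -> conn Y (H :\: D).

Lemma attached_sub d e D Y H : attached d Y H -> #|D| + e <= d -> attached e Y (H :\: D).
Proof.
move=> h de E cE; rewrite setDDl; apply: h.
by have := cardsU D E; lia.
Qed.

Lemma attached_leq e d Y H : e <= d -> attached d Y H -> attached e Y H.
Proof. by move=> ed h D cD; apply: h; apply: leq_trans ed. Qed.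

Lemma attached_conn d Y H : attached d Y H -> conn Y H.
Proof. by move/(_ set0); rewrite cards0 setD0; apply. Qed.

Lemma dpath_conn S1 X1 Y1 S2 X2 Y2 : dpath S1 X1 Y1 -> dpath S2 X2 Y2 ->
  [disjoint S1 & S2] -> conn Y1 Y2 -> dpath (S1 :|: S2) X1 X2.
Proof.
move=> d1 /dpath_sym d2 dS /connP[x [x' [y [y' [xY x'Y yY y'Y [r r']]]]]].
have [xx' _ _] := red_neq r; have [_ _ yy'] := red_neq r'.
have := @dpath_merge _ c _ _ _ _ _ _ x x' [::] y y' d1 d2 dS xY x'Y xx' yY y'Y yy' isT.
by rewrite set_nil setU0; apply; rewrite //= r r'.
Qed.

Lemma dpath_append S X Y H : dpath S X Y -> [disjoint S & H] -> rclique H -> conn Y H ->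
  exists2 H' : {set T}, H' \subset H /\ #|H| <= #|H'| + 2 & dpath (S :|: H) X H'.
Proof.
move=> d dSH kH /connP[x [x' [y [y' [xY x'Y yH y'H [r r']]]]]].
have [xx' _ _] := red_neq r; have [_ _ yy'] := red_neq r'.
exists (H :\: [set y; y']).
  by split; [apply: subsetDl | apply: leq_cardD2].
have dH : dpath H [set y; y'] (H :\: [set y; y']).
  apply: dpath_rclique => //; first by apply/pred0P=> z /=; rewrite in_setD andbA andbN.
  apply/setP=> z; rewrite !inE; have [->|_] := eqVneq z y; first by rewrite yH.
  by have [->|_] := eqVneq z y'; first by rewrite y'H.
have := @dpath_merge _ c _ _ _ _ _ _ x x' [::] y y' d dH dSH xY x'Y xx' _ _ yy' isT.
by rewrite set_nil setU0; apply; rewrite //= ?inE ?eqxx ?orbT // r r'.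
Qed.

(** A bridge whose vertices have been taken out of the hubs: since x, x' still complete A to a
    clique, it can be entered from any two vertices of A, and likewise at B. Shrinking the hubs
    therefore does not damage it. *)
Definition link A x x' m y' y B :=
  [/\ rclique (x |: (x' |: A)), rclique (y |: (y' |: B)),
      tight (x :: x' :: m ++ [:: y'; y]), uniq (x :: x' :: m ++ [:: y'; y])
    & forall z, z \in x :: x' :: m ++ [:: y'; y] -> z \notin A :|: B].

Lemma link_sub A x x' m y' y B A' B' : A' \subset A -> B' \subset B ->
  link A x x' m y' y B -> link A' x x' m y' y B'.
Proof.
move=> sA sB [k1 k2 t u h]; split=> //.
- by apply: rclique_sub k1; rewrite !setUS.
- by apply: rclique_sub k2; rewrite !setUS.
- by move=> z /h; rewrite !inE !negb_or => /andP[zA zB];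
    rewrite (contra (subsetP sA z)) // (contra (subsetP sB z)).
Qed.

Lemma rev_ends x x' m y' y :
  rev (x :: x' :: m ++ [:: y'; y]) = y :: y' :: rev m ++ [:: x'; x].
Proof. by rewrite !rev_cons rev_cat -!cats1 -!catA. Qed.

Lemma link_sym A x x' m y' y B : link A x x' m y' y B -> link B y y' (rev m) x' x A.
Proof.
rewrite /link -rev_ends; case=> k1 k2 t u h; split=> //; rewrite ?tight_rev ?rev_uniq //.
by move=> z; rewrite mem_rev setUC; apply: h.
Qed.

(** Both paths reach the link through two vertices of their hub, so the joint uses at most 2 + 7 + 2
    = 11 new vertices. *)
Lemma dpath_link A x x' m y' y B S1 X1 Y1 S2 X2 Y2 :
  link A x x' m y' y B -> size m <= 3 -> dpath S1 X1 Y1 -> dpath S2 X2 Y2 ->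
  [disjoint S1 & S2] -> [disjoint S1 :|: S2 & A] -> [disjoint S1 :|: S2 & B] ->
  (forall z, z \in x :: x' :: m ++ [:: y'; y] -> z \notin S1 :|: S2) ->
  attached 2 Y1 A -> attached 2 Y2 B ->
  exists2 E : {set T}, #|E| <= 11 /\ E \subset A :|: B :|: [set z in x :: x' :: m ++ [:: y'; y]]
    & dpath (S1 :|: S2 :|: E) X1 X2.
Proof.
move=> [kA kB t0 u0 l0] cm d1 /dpath_sym d2 dS dA dB lS /attached_conn aA aB.
case/connP: aA => p [p' [a [a' [pY p'Y aA a'A [r1 r2]]]]].
(* A and B may coincide; the two allowed deletions make b, b' avoid a, a'. *)
have [|q [q' [b [b' [qY q'Y bB b'B [r3 r4]]]]]] := connP _ _ _ (aB [set a; a'] _).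
  by rewrite cards2; case: (_ == _).
have [pp' _ _] := red_neq r1; have [_ _ aa'] := red_neq r2.
have [qq' _ _] := red_neq r3; have q'q : q' != q by rewrite eq_sym.
have [_ _ bb'] := red_neq r4.
set l0' := x :: x' :: m ++ [:: y'; y] in t0 u0 l0 lS *.
move: bB b'B; rewrite !inE !negb_or => /andP[/andP[ba ba'] bB] /andP[/andP[b'a b'a'] b'B].
pose l := [:: a; a'] ++ l0' ++ [:: b'; b].
have l0A z : z \in l0' -> z \notin A by move=> /l0; rewrite inE negb_or => /andP[].
have l0B z : z \in l0' -> z \notin B by move=> /l0; rewrite inE negb_or => /andP[].
have neqA z w : z \in l0' -> w \in A -> z != w by move=> /l0A zA; apply: contraTneq => <-.
have neqB z w : z \in l0' -> w \in B -> z != w by move=> /l0B zA; apply: contraTneq => <-.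
have [xl x'l y'l yl] : [/\ x \in l0', x' \in l0', y' \in l0' & y \in l0'].
  by rewrite /l0' !(inE, mem_cat) !eqxx !orbT.
exists [set z in l].
  split; first by apply: leq_trans (cards_seq _) _; rewrite /l /l0' /= !size_cat /=; clear -cm; lia.
  apply/subsetP=> z; rewrite [in X in X -> _]inE /l !mem_cat !inE.
  case/or3P=> [/orP[]/eqP->|->|/orP[]/eqP->];
  by rewrite ?aA ?a'A ?bB ?b'B ?orbT.
apply: (@dpath_merge _ c S1 X1 Y1 S2 Y2 X2 p p' l q' q) => //.
- rewrite /l (cat_uniq [:: a; a']) (cat_uniq l0') u0; apply/and3P; split.
  + by rewrite /= inE aa'.
  + apply/hasPn=> z; rewrite mem_cat => /orP[zl|].
      by rewrite !inE negb_or !(neqA z).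
    by rewrite !inE => /orP[]/eqP->; rewrite negb_or ?b'a ?ba.
  + apply/and3P; split=> //; last by rewrite /= inE eq_sym bb'.
    apply/hasPn=> z; rewrite !inE => zb; apply/negP=> /l0B.
    by case/orP: zb => /eqP->; rewrite ?bB ?b'B.
- have nA z : z \in A -> z \notin S1 :|: S2 by move=> zA; rewrite (disjointFl dA).
  have nB z : z \in B -> z \notin S1 :|: S2 by move=> zA; rewrite (disjointFl dB).
  move=> z; rewrite /l !mem_cat => /or3P[|/lS//|]; rewrite !inE => /orP[]/eqP->;
  have := (nA, nB) => -[h h']; by [rewrite -in_setU h | rewrite -in_setU h'].
have -> : p :: p' :: l ++ [:: q'; q] =
    [:: p; p'; a; a'] ++ x :: x' :: m ++ y' :: y :: [:: b'; b; q'; q].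
  by rewrite /l /l0' -!catA /= -!catA.
have tB : tight [:: y', y, b', b & [:: q'; q]].
  rewrite /= !andbT (red_rev _ b' b q') (red_rev _ b q' q) r3 r4 !andbT.
  apply/andP; split; apply: kB; rewrite ?inE ?eqxx ?bB ?b'B ?orbT //=.
    have y'y : y' != y.
      move: u0; rewrite /l0' -!cat_cons cat_uniq => /and3P[_ _ /=].
      by rewrite inE => /andP[].
    by rewrite !inE negb_or y'y !neqB.
  by rewrite !inE negb_or (eq_sym b') bb' !neqB.
have t1 : tight (x :: x' :: m ++ y' :: y :: [:: b'; b; q'; q]).
  have := tight_cat c (x :: x' :: m) y' y [:: b'; b; q'; q].
  by rewrite !cat_cons => ->; rewrite t0 tB.
have xx' : x != x' by move: u0; rewrite /= !inE negb_or -andbA => /and3P[].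
change (red p p' a && (red p' a a' && (red a a' x && (red a' x x' &&
  tight (x :: x' :: m ++ y' :: y :: [:: b'; b; q'; q]))))).
rewrite r1 r2 t1 andbT !andTb; apply/andP; split; apply: kA; rewrite ?inE ?eqxx ?aA ?a'A ?orbT //=.
  by rewrite !inE negb_or aa' ![_ == x]eq_sym !neqA.
by rewrite !inE negb_or xx' ![a' == _]eq_sym !neqA.
Qed.

End Hubs.

(** * Absorbing the remaining vertices *)

Section Finalize.

Context (T : finType) (c : {set T} -> bool).
Implicit Types (x y z v w : T) (s t l m : seq T) (A B C D E H S X Y Z U W : {set T}).
Notation red := (red c).
Notation blue := (blue c).
Notation rclique := (rclique c).
Notation blue2 := (blue2 c).
Notation tight := (tight c).
Notation conn := (conn c).
Notation dpath := (dpath c).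
Notation red_path := (red_path c).
Notation attached := (attached c).
Notation link := (link c).

(** Four vertices of H are set aside as a link with empty middle from the rest of H to itself; 6 is
    these four plus the two deletions required by [dpath_link]. *)
Lemma dpath_same_hub H S1 X1 Y1 S2 X2 Y2 :
  rclique H -> 4 <= #|H| -> dpath S1 X1 Y1 -> dpath S2 X2 Y2 ->
  [disjoint S1 & S2] -> [disjoint S1 :|: S2 & H] -> attached 6 Y1 H -> attached 6 Y2 H ->
  exists2 E : {set T}, #|E| <= 11 /\ E \subset H & dpath (S1 :|: S2 :|: E) X1 X2.
Proof.
move=> kH cH d1 d2 dS dH a1 a2.
have [|[|x [|x' [|y' [|y [|? ?]]]]] [// _ ul lH]] := @pickn T H set0 4; first by rewrite cards0.
pose D := [set z in [:: x; x'; y'; y]].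
have cD : #|D| <= 4 by apply: cards_seq.
have inH z : z \in [:: x; x'; y'; y] -> z \in H by move=> /lH/andP[].
have [xH x'H y'H yH] : [/\ x \in H, x' \in H, y' \in H & y \in H].
  by split; apply: inH; rewrite !inE eqxx ?orbT.
have lk : link (H :\: D) x x' [::] y' y (H :\: D).
  split=> //.
  - by apply: rclique_sub kH; rewrite !subUset !sub1set xH x'H subsetDl.
  - by apply: rclique_sub kH; rewrite !subUset !sub1set yH y'H subsetDl.
  - apply: tight_rclique => //; apply: rclique_sub kH.
    by apply/subsetP=> z; rewrite inE => /inH.
  - by move=> z zl; rewrite setUid !inE negb_and; rewrite !inE in zl; rewrite zl.
have dHD : [disjoint S1 :|: S2 & H :\: D] by apply: disjointWr dH; apply: subsetDl.
have [|||E [cE sE] dE] := dpath_link lk isT d1 d2 dS dHD dHD.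
- by move=> z /inH zH; rewrite (disjointFl dH).
- by apply: attached_sub a1 _; clear -cD; lia.
- by apply: attached_sub a2 _; clear -cD; lia.
exists E => //; split=> //; apply: subset_trans sE _.
rewrite setUid subUset subsetDl; apply/subsetP=> z; rewrite inE; exact: inH.
Qed.

(** The path crosses the link and then swallows the whole of B, all but two vertices of which form
    its new flexible end. *)
Lemma dpath_link_append A x x' m y' y B S X Y :
  link A x x' m y' y B -> size m <= 3 -> dpath S X Y -> 2 <= #|B| ->
  [disjoint S & A] -> [disjoint S & B] -> [disjoint A & B] ->
  (forall z, z \in x :: x' :: m ++ [:: y'; y] -> z \notin S) ->
  conn Y A ->
  exists E : {set T}, exists2 B' : {set T},
    [/\ #|E| <= 11, E \subset A :|: [set z in x :: x' :: m ++ [:: y'; y]],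
        B' \subset B & #|B| <= #|B'| + 2]
    & dpath (S :|: B :|: E) X B'.
Proof.
move=> [kA kB t0 u0 l0] cm d1 cB dA dB dAB lS.
case/connP=> p [p' [a [a' [pY p'Y aA a'A [r1 r2]]]]].
have [|[|b [|b' [|? ?]]] [// _ ub bB]] := @pickn T B set0 2; first by rewrite cards0.
have [pp' _ _] := red_neq r1; have [_ _ aa'] := red_neq r2.
have bb' : b != b' by distinct ub.
have {}inB z : z \in [:: b; b'] -> z \in B by move=> /bB/andP[].
have [bB' b'B] : b \in B /\ b' \in B by split; apply: inB; rewrite !inE eqxx ?orbT.
set l0' := x :: x' :: m ++ [:: y'; y] in t0 u0 l0 lS *.
pose l := [:: a; a'] ++ l0'.
have l0A z : z \in l0' -> z \notin A by move=> /l0; rewrite inE negb_or => /andP[].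
have l0B z : z \in l0' -> z \notin B by move=> /l0; rewrite inE negb_or => /andP[].
have neqA z w : z \in l0' -> w \in A -> z != w by move=> /l0A zA; apply: contraTneq => <-.
have neqB z w : z \in l0' -> w \in B -> z != w by move=> /l0B zA; apply: contraTneq => <-.
have [xl x'l y'l yl] : [/\ x \in l0', x' \in l0', y' \in l0' & y \in l0'].
  by rewrite /l0' !(inE, mem_cat) !eqxx !orbT.
have dBp : dpath B [set b; b'] (B :\: [set b; b']).
  apply: dpath_rclique.
  - by apply: rclique_sub kB; apply/subsetP=> z zB; rewrite !inE zB !orbT.
  - by apply/pred0P=> z /=; rewrite in_setD andbA andbN.
  - apply/setP=> z; rewrite !inE; have [->|_] := eqVneq z b; first by rewrite bB'.
    by have [->|_] := eqVneq z b'; first by rewrite b'B.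
exists [set z in l], (B :\: [set b; b']).
  split.
  - by apply: leq_trans (cards_seq _) _; rewrite /l /l0' /= !size_cat /=; clear -cm; lia.
  - apply/subsetP=> z; rewrite [in X in X -> _]inE /l mem_cat !inE.
    by case/orP=> [/orP[]/eqP->|->]; rewrite ?aA ?a'A ?orbT.
  - exact: subsetDl.
  - exact: leq_cardD2.
apply: (@dpath_merge _ c S X Y B [set b; b'] _ p p' l b b') => //; rewrite ?inE ?eqxx ?orbT //.
- rewrite /l (cat_uniq [:: a; a']) u0 andbT; apply/andP; split.
  + by rewrite /= inE aa'.
  + by apply/hasPn=> z zl; rewrite !inE negb_or !(neqA z).
- move=> z; rewrite /l mem_cat in_setU negb_or => /orP[|zl]; last by rewrite lS ?l0B.
  have nA w : w \in A -> (w \notin S) && (w \notin B).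
    by move=> wA; rewrite (disjointFl dA) // (disjointFr dAB).
  by rewrite !inE => /orP[]/eqP->; apply: nA.
have y'y : y' != y.
  move: u0; rewrite /l0' -!cat_cons cat_uniq => /and3P[_ _ /=].
  by rewrite inE => /andP[].
have tB : tight [:: y', y, b & [:: b']].
  rewrite /= !andbT; apply/andP; split; apply: kB; rewrite ?inE ?eqxx ?bB' ?b'B ?orbT //=.
    by rewrite !inE negb_or y'y !neqB.
  by rewrite !inE negb_or bb' !neqB.
have t1 : tight (x :: x' :: m ++ y' :: y :: [:: b; b']).
  have := tight_cat c (x :: x' :: m) y' y [:: b; b'].
  by rewrite !cat_cons => ->; rewrite t0 tB.
have xx' : x != x' by move: u0; rewrite /= !inE negb_or -andbA => /and3P[].
have -> : p :: p' :: l ++ [:: b; b'] = [:: p; p'; a; a'] ++ x :: x' :: m ++ y' :: y :: [:: b; b'].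
  by rewrite /l /l0' -!catA /= -!catA.
change (red p p' a && (red p' a a' && (red a a' x && (red a' x x' &&
  tight (x :: x' :: m ++ y' :: y :: [:: b; b']))))).
rewrite r1 r2 t1 andbT !andTb; apply/andP; split; apply: kA; rewrite ?inE ?eqxx ?aA ?a'A ?orbT //=.
  by rewrite !inE negb_or aa' ![_ == x]eq_sym !neqA.
by rewrite !inE negb_or xx' ![a' == _]eq_sym !neqA.
Qed.

Lemma red_path_dpath S X Y n : dpath S X Y -> n <= #|S| -> red_path n.
Proof. by case/dpath_tight=> s [us ts <-] ns; exists s. Qed.

Hypothesis noF : no_fano c.

Lemma absorb_near S X Y v D : dpath S X Y -> v \notin S -> #|D| <= 2 -> 6 <= #|Y| ->
  (forall x x', x \in Y :\: D -> x' \in Y :\: D -> ~~ blue v x x') ->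
  exists2 Y' : {set T}, Y' \subset Y /\ #|Y'| + 4 = #|Y| & dpath (v |: S) X Y'.
Proof.
move=> d vS cD cY h.
have [|[|a [|b [|x [|y [|? ?]]]]] [// _ us sY]] := @pickn T Y D 4; first by lia.
have sY' : {subset [:: a; b; x; y] <= Y} by move=> z /sY/andP[].
have r z w : z \in [:: a; b; x; y] -> w \in [:: a; b; x; y] -> z != w -> red v z w.
  move=> /sY/andP[zY zD] /sY/andP[wY wD] zw.
  have vY q : q \in Y -> v != q.
    by move=> qY; apply: contraNneq vS => ->; apply: subsetP (proj2 (dpath_sub d)) q qY.
  by rewrite redE // ?vY // h // inE ?zD ?wD.
apply: (dpath_absorb d vS us sY').
- by rewrite -red_rot; apply: r; rewrite ?inE ?eqxx ?orbT //; distinct us.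
- by rewrite red_swap; apply: r; rewrite ?inE ?eqxx ?orbT //; distinct us.
- by apply: r; rewrite ?inE ?eqxx ?orbT //; distinct us.
Qed.

(** The arrow from E1 to E2 passes to subsets, so the dichotomy applies again after every insertion.
    Each one costs four vertices of an end and needs six, because up to two may be exceptional. For
    u = 0 the paths partition all vertices and one has at least n. *)
Lemma absorb_all n u S1 X1 E1 S2 X2 E2 : #|T| = 2 * n - 1 ->
  dpath S1 X1 E1 -> dpath S2 X2 E2 -> [disjoint S1 & S2] -> blue2 E1 E2 ->
  4 * u + 6 <= #|E1| -> 4 * u + 6 <= #|E2| -> #|~: (S1 :|: S2)| <= u -> red_path n.
Proof.
move=> cT; elim: u S1 E1 S2 E2 => [|u IHu] S1 E1 S2 E2 d1 d2 dS bl c1 c2 cU.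
  have := cardsC (S1 :|: S2); rewrite cardsU (disjoint_setI0 dS) cards0 cT subn0.
  have [h _|h e] := leqP n #|S1|; first exact: red_path_dpath d1 h.
  by apply: red_path_dpath d2 _; lia.
have [|] := posnP #|~: (S1 :|: S2)|.
  by move=> U0; apply: (IHu S1 E1 S2 E2); rewrite ?U0 //; lia.
case/card_gt0P=> v; rewrite !inE negb_or => /andP[v1 v2].
have cU' (R : {set T}) : R = v |: (S1 :|: S2) -> #|~: R| <= u.
  move=> ->; rewrite setCU setIC -setDE; move: cU; rewrite (cardsD1 v).
  by rewrite !inE negb_or v1 v2.
have near1 (D : {set T}) : #|D| <= 2 ->
    (forall x x', x \in E1 :\: D -> x' \in E1 :\: D -> ~~ blue v x x') -> red_path n.
  move=> cD h; have [|Y' [sY cY] d] := absorb_near d1 v1 cD _ h; first by lia.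
  apply: (IHu (v |: S1) Y' S2 E2) => //; try lia; last by apply: cU'; rewrite setUA.
    by rewrite -setI_eq0 setIUl (disjoint_setI0 dS) setU0 setI_eq0 disjoints1.
  exact: blue2_sub sY (subxx _) bl.
have near2 (D : {set T}) : #|D| <= 2 ->
    (forall x x', x \in E2 :\: D -> x' \in E2 :\: D -> ~~ blue v x x') -> red_path n.
  move=> cD h; have [|Y' [sY cY] d] := absorb_near d2 v2 cD _ h; first by lia.
  apply: (IHu S1 E1 (v |: S2) Y') => //; try lia; last by apply: cU'; rewrite setUCA.
    by rewrite -setI_eq0 setIUr (disjoint_setI0 dS) setU0 setI_eq0 disjoint_sym disjoints1.
  exact: blue2_sub (subxx _) sY bl.
have [[D cD h]|h] := link_dichotomy noF v bl; first exact: near1 cD h.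
by apply: (near2 set0); rewrite ?cards0 // => x x'; rewrite !setD0; apply: h.
Qed.

Lemma absorb_hubs n u S1 X1 Y1 S2 X2 Y2 H1 H2 : #|T| = 2 * n - 1 ->
  dpath S1 X1 Y1 -> dpath S2 X2 Y2 -> [disjoint S1 & S2] ->
  rclique H1 -> rclique H2 -> blue2 H1 H2 ->
  [disjoint S1 & H1] -> [disjoint S1 & H2] -> [disjoint S2 & H1] -> [disjoint S2 & H2] ->
  conn Y1 H1 -> conn Y2 H2 -> 4 * u + 8 <= #|H1| -> 4 * u + 8 <= #|H2| ->
  #|~: (S1 :|: S2 :|: H1 :|: H2)| <= u -> red_path n.
Proof.
move=> cT d1 d2 dS k1 k2 bl dS11 dS12 dS21 dS22 n1 n2 c1 c2 cU.
have dH : [disjoint H1 & H2] by apply: blue2_disjoint bl; lia.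
have [E1 [s1 e1] p1] := dpath_append d1 dS11 k1 n1.
have [E2 [s2 e2] p2] := dpath_append d2 dS22 k2 n2.
apply: (absorb_all cT p1 p2 (u := u)).
- rewrite -setI_eq0 setIUl !setIUr (disjoint_setI0 dS) (disjoint_setI0 dS12).
  by rewrite (disjoint_setI0 dH) setIC (disjoint_setI0 dS21) !setU0.
- exact: blue2_sub s1 s2 bl.
- by clear -c1 e1; lia.
- by clear -c2 e2; lia.
- apply: leq_trans cU; apply: subset_leq_card; rewrite setCS.
  by apply/subsetP=> z; rewrite !inE => /orP[/orP[/orP[]|]|] ->; rewrite ?orbT.
Qed.

Lemma rclique_of_link A x x' m y' y B : link A x x' m y' y B -> rclique A /\ rclique B.
Proof.
by case=> k1 k2 _ _ _; split; [apply: rclique_sub k1 | apply: rclique_sub k2];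
  apply/subsetP=> z zA; rewrite !inE zA !orbT.
Qed.

(** The hub B serves only for transit: the reversed link carries the first path from B to A, after
    which the two paths end in A and C, with the arrow from C to A. *)
Lemma absorb_across_link n u A x x' m y' y B C S1 X1 Y1 S2 X2 Y2 : #|T| = 2 * n - 1 ->
  link A x x' m y' y B -> size m <= 3 -> rclique C -> blue2 C A ->
  [disjoint A & B] -> [disjoint B & C] ->
  (forall z, z \in x :: x' :: m ++ [:: y'; y] -> z \notin S1 :|: S2 :|: C) ->
  [disjoint S1 & A] -> [disjoint S2 & A] -> [disjoint S1 & B] -> [disjoint S2 & B] ->
  [disjoint S1 & C] -> [disjoint S2 & C] ->
  dpath S1 X1 Y1 -> dpath S2 X2 Y2 -> [disjoint S1 & S2] ->
  conn Y1 B -> conn Y2 C ->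
  4 * u + 10 <= #|A| -> 4 * u + 10 <= #|C| ->
  #|~: (S1 :|: S2 :|: A :|: C)| <= u -> red_path n.
Proof.
move=> cT lk cm kC CA dAB dBC lS dA1 dA2 dB1 dB2 dC1 dC2 d1 d2 dS n1 n2 cA cC cU.
have [A2 C2] : 2 <= #|A| /\ 2 <= #|C| by clear -cA cC; lia.
have dCA : [disjoint C & A] by apply: blue2_disjoint CA.
have [E1 [s1 e1] p2] := dpath_append d2 dC2 kC n2.
have lk' := link_sym lk.
have rl z : z \in y :: y' :: rev m ++ [:: x'; x] -> z \in x :: x' :: m ++ [:: y'; y].
  by rewrite -rev_ends mem_rev.
have [|||E [E2 [cE sE s2 e2] p1]] :=
  dpath_link_append lk' _ d1 A2 dB1 dA1 _ _ n1; rewrite ?size_rev //.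
- by rewrite disjoint_sym.
- by move=> z /rl/lS; rewrite !inE !negb_or -andbA => /and3P[].
have dE2 : [disjoint E & S2 :|: C].
  apply: disjointWl sE _; apply/pred0P=> z /=; apply/negP=> /andP[].
  rewrite !inE => /orP[zB|/rl/lS].
    by rewrite (disjointFl dB2) // (disjointFr dBC).
  by rewrite !inE !negb_or -andbA => /and3P[_ /negbTE-> /negbTE->].
apply: (absorb_all cT p2 p1 (u := u)).
- rewrite -setI_eq0 !setIUr !setIUl [S2 :&: S1]setIC [C :&: S1]setIC.
  rewrite (disjoint_setI0 dS) (disjoint_setI0 dC1) (disjoint_setI0 dA2) (disjoint_setI0 dCA).
  by rewrite -setIUl setIC (disjoint_setI0 dE2) !setU0.
- exact: blue2_sub s1 s2 CA.
- by clear -cC e1; lia.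
- by clear -cA e2; lia.
- apply: leq_trans cU; apply: subset_leq_card; rewrite setCS.
  by apply/subsetP=> z; rewrite !inE => /orP[/orP[/orP[]|]|] ->; rewrite ?orbT.
Qed.

(** Two ends at the same hub, or at A and B, are joined to a single path. Ends at A and C absorb
    directly, ends at B and C after crossing the link. In the two absorbing cases, what is left of B
    counts among the leftover vertices. *)
Lemma two_paths n u A x x' m y' y B C S1 X1 Y1 S2 X2 Y2 : #|T| = 2 * n - 1 ->
  link A x x' m y' y B -> size m <= 3 -> rclique C -> blue2 C A ->
  [disjoint A & B] -> [disjoint B & C] ->
  (forall z, z \in x :: x' :: m ++ [:: y'; y] -> z \notin S1 :|: S2 :|: C) ->
  [disjoint S1 :|: S2 & A] -> [disjoint S1 :|: S2 & B] -> [disjoint S1 :|: S2 & C] ->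
  dpath S1 X1 Y1 -> dpath S2 X2 Y2 -> [disjoint S1 & S2] ->
  [\/ attached 6 Y1 A, attached 6 Y1 B | attached 6 Y1 C] ->
  [\/ attached 6 Y2 A, attached 6 Y2 B | attached 6 Y2 C] ->
  4 <= #|B| -> 4 * u + 10 <= #|A| -> 4 * u + 10 <= #|C| ->
  #|~: (S1 :|: S2 :|: A :|: C)| <= u -> n <= #|S1 :|: S2| -> red_path n.
Proof.
move=> cT lk cm kC CA dAB dBC lSC dA dB dC d1 d2 dS h1 h2 cB cA cC cU cS.
have [kA kB] := rclique_of_link lk.
have lS z : z \in x :: x' :: m ++ [:: y'; y] -> z \notin S1 :|: S2.
  by move=> /lSC; rewrite inE negb_or => /andP[].
have dS' : [disjoint S2 & S1] by rewrite disjoint_sym.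
have split_disj (R : {set T}) : [disjoint S1 :|: S2 & R] -> [disjoint S1 & R] /\ [disjoint S2 & R].
  by move=> d; split; apply: disjointWl d; rewrite ?subsetUl ?subsetUr.
have [[dA1 dA2] [dB1 dB2] [dC1 dC2]] := And3 (split_disj _ dA) (split_disj _ dB) (split_disj _ dC).
have [[A4 A8] [C4 C8]] : (4 <= #|A| /\ 4 * u + 8 <= #|A|) /\ (4 <= #|C| /\ 4 * u + 8 <= #|C|).
  by clear -cA cC; lia.
have same H : rclique H -> 4 <= #|H| -> [disjoint S1 :|: S2 & H] ->
    attached 6 Y1 H -> attached 6 Y2 H -> red_path n.
  move=> kH cH dH a1 a2; have [E _ p] := dpath_same_hub kH cH d1 d2 dS dH a1 a2.
  by apply: red_path_dpath p _; apply: leq_trans cS _; rewrite subset_leq_card ?subsetUl.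
have swapU : S2 :|: S1 = S1 :|: S2 by rewrite setUC.
case: h1 h2 => a1 [] a2.
- exact: (same A).
- have [||E _ p] := dpath_link lk cm d1 d2 dS dA dB lS.
  + exact: attached_leq a1.
  + exact: attached_leq a2.
  by apply: red_path_dpath p _; apply: leq_trans cS _; rewrite subset_leq_card ?subsetUl.
- apply: (absorb_hubs cT d2 d1 dS' kC kA CA (u := u)) => //.
  + exact: attached_conn a2.
  + exact: attached_conn a1.
  + by rewrite swapU -setUA [C :|: A]setUC setUA.
- have [|||||E _ p] := dpath_link lk cm d2 d1 dS'; rewrite ?swapU //.
  + by apply: attached_leq a2.
  + by apply: attached_leq a1.
  by apply: red_path_dpath p _; apply: leq_trans cS _; rewrite swapU subset_leq_card ?subsetUl.
- exact: (same B).
- by apply: (absorb_across_link (u := u) cT lk cm kC CA dAB dBC _ _ _ _ _ _ _ d1 d2) => //;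
    [exact: attached_conn a1 | exact: attached_conn a2].
- apply: (absorb_hubs cT d1 d2 dS kC kA CA (u := u)) => //.
  + exact: attached_conn a1.
  + exact: attached_conn a2.
  + by rewrite -setUA [C :|: A]setUC setUA.
- by apply: (absorb_across_link (u := u) cT lk cm kC CA dAB dBC _ _ _ _ _ _ _ d2 d1) => //;
    rewrite ?swapU //; [exact: attached_conn a2 | exact: attached_conn a1].
- exact: (same C).
Qed.

End Finalize.

(** * Families of disjoint paths *)

Lemma not_pairwise (T : eqType) (r : rel T) (s : seq T) : ~~ pairwise r s ->
  exists x y t, perm_eq s [:: x, y & t] /\ ~~ r x y.
Proof.
elim: s => //= x s IHs; rewrite negb_and => /orP[|/IHs[y [z [t [p nr]]]]].
  rewrite -has_predC => /hasP[y ys /= nr]; exists x, y, (rem y s).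
  by rewrite perm_cons perm_to_rem.
exists y, z, (x :: t); split=> //.
rewrite -(perm_cons x) in p; apply: perm_trans p _.
by rewrite -[[:: y, z & t]]/([:: y; z] ++ t) (perm_catCA [:: x] [:: y; z] t).
Qed.

Section Families.

Context (T : finType) (c : {set T} -> bool).
Implicit Types (x y z v w : T) (s t l m : seq T) (A B C D E H S X Y Z U W Q : {set T}).
Notation red := (red c).
Notation blue := (blue c).
Notation rclique := (rclique c).
Notation blue2 := (blue2 c).
Notation tight := (tight c).
Notation conn := (conn c).
Notation dpath := (dpath c).
Notation red_path := (red_path c).
Notation attached := (attached c).
Notation link := (link c).
Notation triple := ({set T} * {set T} * {set T})%type.
Implicit Types (F : seq triple).

Lemma attachedPn d Y H :
  attached d Y H \/ exists2 D : {set T}, #|D| <= d & ~~ conn Y (H :\: D).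
Proof.
have [/forall_inP h|] := boolP [forall (D : {set T} | #|D| <= d), conn Y (H :\: D)].
  by left=> D; apply: h.
by rewrite negb_forall_in => /exists_inP[D cD nc]; right; exists D.
Qed.

Definition member k W (d : triple) :=
  [/\ dpath d.1.1 d.1.2 d.2, rclique d.1.2 /\ rclique d.2,
      #|d.1.2| = k /\ #|d.2| = k & d.1.1 \subset W].

Definition path_family k W F :=
  (forall x, count (fun d : triple => x \in d.1.1) F <= 1) /\
  (forall d : triple, d \in F -> member k W d).

Definition uncovered W F :=
  [set x in W | all (fun d : triple => x \notin d.1.1) F].

(** Only second ends are compared. A merge uses two second ends and keeps the two first ends, so the
    merged path is again a member of the family. *)
Definition disconnected F :=
  pairwise (fun d e : triple => ~~ conn d.2 e.2) F.

Lemma family_perm k W F F' : perm_eq F F' -> path_family k W F -> path_family k W F'.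
Proof.
move=> p [h1 h2]; split=> [x|d]; first by rewrite -(permP p).
by rewrite -(perm_mem p); apply: h2.
Qed.

Lemma family_disjoint k W d e F : path_family k W [:: d, e & F] -> [disjoint d.1.1 & e.1.1].
Proof.
case=> h _; apply/pred0P=> x /=; apply/negbTE/negP=> /andP[xd xe].
by have := h x; rewrite /= xd xe.
Qed.

Lemma family_behead k W d F : path_family k W (d :: F) -> path_family k W F.
Proof.
case=> h1 h2; split=> [x|e eF]; last by apply: h2; rewrite inE eF orbT.
by apply: leq_trans (h1 x); rewrite /= leq_addl.
Qed.

Lemma family_merge k W F : path_family k W F -> ~~ disconnected F ->
  exists F', [/\ path_family k W F', size F = (size F').+1 & uncovered W F' = uncovered W F].
Proof.
move=> fF /not_pairwise[d [e [F' [p]]]]; rewrite negbK => nde.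
have := family_perm p fF; case: d e nde p => [[S1 X1] Y1] [[S2 X2] Y2] /= n12 p fF'.
have dS := family_disjoint fF'; rewrite /= in dS.
have [h1 h2] := fF'.
have [d1 [kX1 kY1] [cX1 cY1] sS1] := h2 _ (mem_head _ _).
have [|d2 [kX2 kY2] [cX2 cY2] sS2] := h2 (S2, X2, Y2); first by rewrite !inE eqxx orbT.
rewrite /= in d1 d2 kX1 kX2 kY1 kY2 cX1 cX2 cY1 cY2 sS1 sS2.
exists ((S1 :|: S2, X1, X2) :: F'); split.
- split=> [x|f].
    by have := h1 x; rewrite /= inE; case: (x \in S1); case: (x \in S2); rewrite ?addnA.
  rewrite inE => /predU1P[->|fF'']; last by apply: h2; rewrite !inE fF'' !orbT.
  by split=> //=; rewrite ?subUset ?sS1 //; apply: dpath_conn d1 d2 dS n12.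
- by rewrite (perm_size p).
- apply/setP=> x; rewrite !inE (perm_all _ p) /= !inE negb_or.
  by rewrite -!andbA.
Qed.

(** As long as N vertices are uncovered, a red clique on 2k of them is split into two ends and added
    as a path; if this makes r + 1 paths, two are merged. Merging leaves the uncovered set
    unchanged, so its size decreases in every round. *)
Lemma family_exists k r N W : 0 < k ->
  (forall S, N <= #|S| -> exists Q, [/\ Q \subset S, #|Q| = k + k & rclique Q]) ->
  (forall F, path_family k W F -> size F = r.+1 -> ~~ disconnected F) ->
  exists F, [/\ path_family k W F, size F <= r & #|uncovered W F| < N].
Proof.
move=> k0 HN H.
suff : forall u F, path_family k W F -> size F <= r -> #|uncovered W F| <= u ->
    exists F, [/\ path_family k W F, size F <= r & #|uncovered W F| < N].
  move=> h; apply: (h #|uncovered W [::]| [::]) => //; by split=> // x.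
elim=> [|u IHu] F fF rF cF.
  have [h|h] := ltnP #|uncovered W F| N; first by exists F.
  have [Q [sQ cQ _]] := HN _ h; have := subset_leq_card sQ; clear -cQ cF k0; lia.
have [h|h] := ltnP #|uncovered W F| N; first by exists F.
have [Q [sQ cQ kQ]] := HN _ h.
have [|X sX cX] := @subset_card T Q k; first by rewrite cQ leq_addr.
pose G := (Q, X, Q :\: X) :: F.
have sW : uncovered W F \subset W by apply/subsetP=> x; rewrite inE => /andP[].
have fG : path_family k W G.
  have [h1 h2] := fF; split=> [x|d].
    rewrite /=; have [xQ|xQ] := boolP (x \in Q); last exact: h1.
    have := subsetP sQ x xQ; rewrite inE => /andP[_ xF].
    rewrite (_ : count _ F = 0) //; apply/eqP; rewrite eqn0Ngt -has_count -all_predC.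
    exact: xF.
  rewrite inE => /predU1P[->|]; last exact: h2.
  split=> /=.
  - apply: dpath_rclique => //; first by apply/pred0P=> z /=; rewrite in_setD andbA andbN.
    by apply/setP=> z; rewrite !inE; case: (boolP (z \in X)) => // /(subsetP sX).
  - by split; [apply: rclique_sub kQ | apply: rclique_sub kQ; apply: subsetDl].
  - split=> //; have := cardsID X Q; rewrite (setIidPr sX) cX cQ; clear; lia.
  - exact: subset_trans sQ sW.
have uG : #|uncovered W G| <= u.
  have : uncovered W G \subset uncovered W F :\: Q.
    by apply/subsetP=> x; rewrite !inE /= => /and3P[-> -> ->].
  move/subset_leq_card; have := cardsID Q (uncovered W F); rewrite (setIidPr sQ) cQ.
  clear -cF k0; lia.
have [h'|h'] := leqP (size G) r; first exact: IHu fG h' uG.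
have [|F' [fF' sF' uF']] := family_merge fG (H _ fG _).
  by apply/eqP; rewrite eqn_leq h' /= ltnS rF.
by apply: (IHu F') => //; [move: sF' => [<-] | rewrite uF'].
Qed.

Hypothesis noF : no_fano c.

(** A first merge uses at most 11 hub vertices and [two_paths] needs robustness 6, hence 17. *)
Lemma three_paths n u A x x' m y' y B C S1 X1 Y1 S2 X2 Y2 S3 X3 Y3 : #|T| = 2 * n - 1 ->
  link A x x' m y' y B -> size m <= 3 -> rclique C -> blue2 C A ->
  [disjoint A & B] -> [disjoint B & C] ->
  (forall z, z \in x :: x' :: m ++ [:: y'; y] -> z \notin S1 :|: S2 :|: S3 :|: C) ->
  [disjoint S1 :|: S2 :|: S3 & A] -> [disjoint S1 :|: S2 :|: S3 & B] ->
  [disjoint S1 :|: S2 :|: S3 & C] ->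
  dpath S1 X1 Y1 -> dpath S2 X2 Y2 -> dpath S3 X3 Y3 ->
  [disjoint S1 & S2] -> [disjoint S1 & S3] -> [disjoint S2 & S3] ->
  (forall Y, Y \in [:: X1; Y1; X2; Y2; X3; Y3] ->
    [\/ attached 17 Y A, attached 17 Y B | attached 17 Y C]) ->
  15 <= #|B| -> 4 * u + 21 <= #|A| -> 4 * u + 21 <= #|C| ->
  #|~: (S1 :|: S2 :|: S3 :|: A :|: C)| <= u -> n <= #|S1 :|: S2 :|: S3| -> red_path n.
Proof.
move=> cT lk cm kC CA dAB dBC; have [kA kB] := rclique_of_link lk.
set U0 := S1 :|: S2 :|: S3 => lU dUA dUB dUC d1 d2 d3 d12 d13 d23 hat cB cA cC cU nU.
have dCA : [disjoint C & A] by apply: blue2_disjoint CA; clear -cC; lia.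
have disjU (P R Z : {set T}) : [disjoint Z & R] -> P \subset Z -> [disjoint P & R].
  by move=> d s; apply: disjointWl s d.
(* The joined path has ends Z1 and Z2; its end Z2 and the end W3 are passed to [two_paths]. *)
have two_same P1 Z1 W1 P2 Z2 W2 P3 Z3 W3 H :
    P1 :|: P2 :|: P3 = U0 -> dpath P1 Z1 W1 -> dpath P2 Z2 W2 -> dpath P3 Z3 W3 ->
    [disjoint P1 & P2] -> [disjoint P1 & P3] -> [disjoint P2 & P3] ->
    Z2 \in [:: X1; Y1; X2; Y2; X3; Y3] -> W3 \in [:: X1; Y1; X2; Y2; X3; Y3] ->
    [\/ H = A, H = B | H = C] -> attached 17 W1 H -> attached 17 W2 H -> red_path n.
  move=> EU p1 p2 p3 q12 q13 q23 hZ hW EH a1 a2.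
  have kH : rclique H by case: EH => ->.
  have cH : 4 <= #|H| by case: EH => ->; clear -cA cB cC; lia.
  have dUH : [disjoint U0 & H] by case: EH => ->.
  have sP1 : P1 :|: P2 \subset U0 by rewrite -EU subsetUl.
  have sP3 : P3 \subset U0 by rewrite -EU subsetUr.
  have [||E [cE sE] p] := dpath_same_hub kH cH p1 p2 q12 (disjU _ _ _ dUH sP1).
  - exact: attached_leq a1.
  - exact: attached_leq a2.
  have sub (Z : {set T}) : #|Z| <= #|Z :\: E| + 11.
    by apply: leq_trans (leq_cardD Z E) _; rewrite leq_add2l.
  have atE Y : Y \in [:: X1; Y1; X2; Y2; X3; Y3] ->
      [\/ attached 6 Y (A :\: E), attached 6 Y (B :\: E) | attached 6 Y (C :\: E)].
    have cE' : #|E| + 6 <= 17 by clear -cE; lia.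
    by case/hat=> h; have := attached_sub h cE'; [apply: Or31 | apply: Or32 | apply: Or33].
  have sH : H \subset A :|: B :|: C.
    by case: EH => ->; apply/subsetP=> z zz; rewrite !inE zz ?orbT.
  have sE' := subset_trans sE sH.
  have dEU : [disjoint E & U0] by rewrite disjoint_sym; apply: disjointWr sE dUH.
  have dd (Z : {set T}) : [disjoint U0 & Z] -> [disjoint P1 :|: P2 :|: E :|: P3 & Z :\: E].
    move=> dZ; apply/pred0P=> z /=; apply/negP=> /andP[+ /setDP[zZ zE]].
    have : z \in U0 -> False by move=> zU; rewrite (disjointFr dZ zU) in zZ.
    by rewrite -EU !inE (negbTE zE) orbF => h /h.
  apply: (two_paths noF (u := u) cT (link_sub (subsetDl A E) (subsetDl B E) lk) cm
    (rclique_sub (subsetDl C E) kC) (blue2_sub (subsetDl C E) (subsetDl A E) CA)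
    _ _ _ (dd _ dUA) (dd _ dUB) (dd _ dUC) p p3 _ (atE _ hZ) (atE _ hW)).
  - by apply: disjointW dAB; apply: subsetDl.
  - by apply: disjointW dBC; apply: subsetDl.
  - move=> z zl; have := lU z zl; have [_ _ _ _ /(_ z zl)] := lk.
    rewrite -EU !inE !negb_or => /andP[zA zB] /andP[/andP[/andP[-> ->] ->] zC].
    rewrite (negbTE zC) andbF !andbT /=; apply/negP=> /(subsetP sE').
    by rewrite !inE (negbTE zA) (negbTE zB) (negbTE zC).
  - apply/pred0P=> z /=; apply/negP=> /andP[/setUP[]] zz z3.
      by move: zz; rewrite inE (disjointFl q13 z3) (disjointFl q23 z3).
    by move: zz; rewrite (disjointFl dEU) // (subsetP sP3).
  - by have := sub B; clear -cB; lia.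
  - by have := sub A; clear -cA; lia.
  - by have := sub C; clear -cC; lia.
  - apply: leq_trans cU; apply: subset_leq_card; rewrite setCS -EU.
    apply/subsetP=> z; rewrite !inE; case: (z \in E); rewrite ?orbT //=.
    by rewrite !orbF.
  - by apply: leq_trans nU _; rewrite -EU; apply: subset_leq_card;
      apply/subsetP=> z; rewrite !inE => /orP[->|->]; rewrite ?orbT.
(* With all hubs occupied, the other end Z1 of the first path must share a hub. At B or C it meets
   W2 or W3 there. At A, the first two paths are joined through the link by W1 and W2, and Z1 and W3
   then absorb at A and C. *)
have distinct_hubs P1 Z1 W1 P2 Z2 W2 P3 Z3 W3 :
    P1 :|: P2 :|: P3 = U0 -> dpath P1 Z1 W1 -> dpath P2 Z2 W2 -> dpath P3 Z3 W3 ->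
    [disjoint P1 & P2] -> [disjoint P1 & P3] -> [disjoint P2 & P3] ->
    {subset [:: Z1; W1; Z2; W2; Z3; W3] <= [:: X1; Y1; X2; Y2; X3; Y3]} ->
    attached 17 W1 A -> attached 17 W2 B -> attached 17 W3 C -> red_path n.
  move=> EU p1 p2 p3 q12 q13 q23 hs a1 a2 a3.
  (* The default [Z1] lies in the list too, so no bound on i is imposed. *)
  have hm i : nth Z1 [:: Z1; W1; Z2; W2; Z3; W3] i \in [:: X1; Y1; X2; Y2; X3; Y3].
    have [li|li] := ltnP i 6; first by apply: hs; apply: mem_nth.
    by rewrite nth_default //; apply: hs; apply: mem_head.
  have q21 : [disjoint P2 & P1] by rewrite disjoint_sym.
  have q32 : [disjoint P3 & P2] by rewrite disjoint_sym.
  have q31 : [disjoint P3 & P1] by rewrite disjoint_sym.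
  case: (hat _ (hm 0)) => a0.
  - have sP : P1 :|: P2 \subset U0 by rewrite -EU subsetUl.
    have [|||E [cE sE] /dpath_sym p] :=
      dpath_link lk cm p1 p2 q12 (disjU _ _ _ dUA sP) (disjU _ _ _ dUB sP).
    + move=> z /lU; rewrite in_setU negb_or => /andP[zU _].
      by apply: contra zU; apply: (subsetP sP).
    + exact: attached_leq a1.
    + exact: attached_leq a2.
    have dE z : z \in E -> (z \in U0) = false /\ (z \in C) = false.
      move=> /(subsetP sE)/setUP[/setUP[zA|zB]|].
      - by split; [apply: disjointFl dUA zA | apply: disjointFl dCA zA].
      - by split; [apply: disjointFl dUB zB | apply: disjointFr dBC zB].
      - by rewrite inE => /lU; rewrite in_setU negb_or => /andP[/negbTE ? /negbTE].
    have sP3 : P3 \subset U0 by rewrite -EU subsetUr.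
    apply: (absorb_hubs noF cT p3 p (H1 := C) (H2 := A :\: E) (u := u)).
    + apply/pred0P=> z /=; apply/negP=> /andP[z3] /setUP[/setUP[]|/dE[]].
      * by rewrite (disjointFl q13 z3).
      * by rewrite (disjointFl q23 z3).
      * by rewrite (subsetP sP3 z z3).
    + exact: kC.
    + exact: rclique_sub (subsetDl A E) kA.
    + exact: blue2_sub (subxx C) (subsetDl A E) CA.
    + exact: disjU dUC sP3.
    + by apply: disjointWr (disjU _ _ _ dUA sP3); apply: subsetDl.
    + apply/pred0P=> z /=; apply/negP=> /andP[/setUP[zP|/dE[_ ->//]]].
      by rewrite (disjointFr dUC) // (subsetP sP).
    + apply/pred0P=> z /=; apply/negP=> /andP[+ /setDP[zA zE]]; rewrite in_setU (negbTE zE) orbF.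
      by move=> /(subsetP sP) zU; rewrite (disjointFr dUA zU) in zA.
    + exact: attached_conn a3.
    + by apply: a0; clear -cE; lia.
    + by clear -cC; lia.
    + by have := leq_cardD A E; clear -cA cE; lia.
    + apply: leq_trans cU; apply: subset_leq_card; rewrite setCS -EU.
      apply/subsetP=> z; rewrite !inE; case: (z \in E); rewrite ?orbT //= ?orbF.
      by case/orP=> [/orP[/orP[/orP[]|]|]|] ->; rewrite ?orbT.
  - apply: (two_same P1 W1 Z1 P2 Z2 W2 P3 Z3 W3 B) => //;
      [exact: dpath_sym | exact: (hm 2) | exact: (hm 5) | exact: Or32].
  - apply: (two_same P1 W1 Z1 P3 Z3 W3 P2 Z2 W2 C) => //;
      [by rewrite setUAC | exact: dpath_sym | exact: (hm 4) | exact: (hm 3) | exact: Or33].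
have d21 : [disjoint S2 & S1] by rewrite disjoint_sym.
have d31 : [disjoint S3 & S1] by rewrite disjoint_sym.
have d32 : [disjoint S3 & S2] by rewrite disjoint_sym.
have E132 : S1 :|: S3 :|: S2 = U0 by rewrite setUAC.
have E213 : S2 :|: S1 :|: S3 = U0 by rewrite [S2 :|: S1]setUC.
have E231 : S2 :|: S3 :|: S1 = U0 by rewrite setUAC [S2 :|: S1]setUC.
have E312 : S3 :|: S1 :|: S2 = U0 by rewrite [S3 :|: S1]setUC setUAC.
have E321 : S3 :|: S2 :|: S1 = U0 by rewrite [S3 :|: S2]setUC E231.
have same12 H : [\/ H = A, H = B | H = C] -> attached 17 Y1 H -> attached 17 Y2 H -> red_path n.
  by apply: (two_same S1 X1 Y1 S2 X2 Y2 S3 X3 Y3) => //; rewrite !inE eqxx !orbT.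
have same13 H : [\/ H = A, H = B | H = C] -> attached 17 Y1 H -> attached 17 Y3 H -> red_path n.
  by apply: (two_same S1 X1 Y1 S3 X3 Y3 S2 X2 Y2) => //; rewrite !inE eqxx !orbT.
have same23 H : [\/ H = A, H = B | H = C] -> attached 17 Y2 H -> attached 17 Y3 H -> red_path n.
  by apply: (two_same S2 X2 Y2 S3 X3 Y3 S1 X1 Y1) => //; rewrite !inE eqxx !orbT.
have [EA EB EC] : [/\ [\/ A = A, A = B | A = C], [\/ B = A, B = B | B = C]
    & [\/ C = A, C = B | C = C]] by split; [apply: Or31 | apply: Or32 | apply: Or33].
have [m1 m2 m3] : [/\ Y1 \in [:: X1; Y1; X2; Y2; X3; Y3], Y2 \in [:: X1; Y1; X2; Y2; X3; Y3]
    & Y3 \in [:: X1; Y1; X2; Y2; X3; Y3]] by rewrite !inE !eqxx !orbT.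
case: (hat _ m1) => a1; case: (hat _ m2) => a2.
- exact: same12 EA a1 a2.
- case: (hat _ m3) => a3.
  + exact: same13 EA a1 a3.
  + exact: same23 EB a2 a3.
  + by apply: (distinct_hubs S1 X1 Y1 S2 X2 Y2 S3 X3 Y3).
- case: (hat _ m3) => a3.
  + exact: same13 EA a1 a3.
  + apply: (distinct_hubs S1 X1 Y1 S3 X3 Y3 S2 X2 Y2) => //; apply/allP.
    by rewrite /= !inE !eqxx !orbT.
  + exact: same23 EC a2 a3.
- case: (hat _ m3) => a3.
  + exact: same23 EA a2 a3.
  + exact: same13 EB a1 a3.
  + apply: (distinct_hubs S2 X2 Y2 S1 X1 Y1 S3 X3 Y3) => //; apply/allP.
    by rewrite /= !inE !eqxx !orbT.
- exact: same12 EB a1 a2.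
- case: (hat _ m3) => a3.
  + apply: (distinct_hubs S3 X3 Y3 S1 X1 Y1 S2 X2 Y2) => //; apply/allP.
    by rewrite /= !inE !eqxx !orbT.
  + exact: same13 EB a1 a3.
  + exact: same23 EC a2 a3.
- case: (hat _ m3) => a3.
  + exact: same23 EA a2 a3.
  + apply: (distinct_hubs S2 X2 Y2 S3 X3 Y3 S1 X1 Y1) => //; apply/allP.
    by rewrite /= !inE !eqxx !orbT.
  + exact: same13 EC a1 a3.
- case: (hat _ m3) => a3.
  + apply: (distinct_hubs S3 X3 Y3 S2 X2 Y2 S1 X1 Y1) => //; apply/allP.
    by rewrite /= !inE !eqxx !orbT.
  + exact: same23 EB a2 a3.
  + exact: same13 EC a1 a3.
- exact: same12 EC a1 a2.
Qed.

End Families.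

(** * The upper bound *)

Lemma triple_bound_gt0 s : 0 < triple_bound s.
Proof.
have h : 0 < 7 * s + 4 by rewrite addnS.
by do 3!apply: leq_trans (leq_big _).
Qed.

Section Upper.

Context (T : finType) (c : {set T} -> bool).
Implicit Types (x y z v w : T) (l m : seq T) (A B C D E H S X Y Z U W Q : {set T}).
Notation rclique := (rclique c).
Notation blue2 := (blue2 c).
Notation tight := (tight c).
Notation conn := (conn c).
Notation dpath := (dpath c).
Notation red_path := (red_path c).
Notation attached := (attached c).
Notation link := (link c).
Notation cyclic_triple := (cyclic_triple c).
Notation bridge := (bridge c).
Notation path_family := (path_family c).
Notation triple := ({set T} * {set T} * {set T})%type.
Implicit Types (F : seq triple) (d e : triple).

Lemma family_pairwise k W F : path_family k W F ->
  pairwise (fun d e => [disjoint d.1.1 & e.1.1]) F.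
Proof.
elim: F => //= d F IHF fF; rewrite (IHF (family_behead fF)) andbT.
apply/allP=> e eF; apply/pred0P=> x /=; apply/negbTE/negP=> /andP[xd xe].
have [/(_ x) + _] := fF; rewrite /= xd add1n ltnS leqNgt -has_count => /hasP[].
by exists e.
Qed.

Lemma member_end k W d : member c k W d ->
  [/\ rclique d.2, #|d.2| = k, d.2 \subset d.1.1 & d.2 \subset W].
Proof.
case=> /dpath_sub[_ s2] [_ kY] [_ cY] sW; split=> //; exact: subset_trans s2 sW.
Qed.

Lemma member_start k W d : member c k W d ->
  [/\ rclique d.1.2, #|d.1.2| = k, d.1.2 \subset d.1.1 & d.1.2 \subset W].
Proof.
case=> /dpath_sub[s1 _] [kX _] [cX _] sW; split=> //; exact: subset_trans s1 sW.
Qed.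

Hypothesis noF : no_fano c.

Lemma three_disconnected k W s F : path_family k W F -> size F = 3 -> disconnected c F ->
  triple_bound s <= k ->
  exists A B C, [/\ cyclic_triple A B C, #|A| = s, #|B| = s & #|C| = s].
Proof.
move=> fF; case: F fF => [|d1 [|d2 [|d3 [|? ?]]]] //= fF _.
have := family_pairwise fF; rewrite /disconnected /= !andbT.
move=> /andP[/andP[D12 D13] D23] /andP[/andP[n12 n13] n23] sk.
have [_ h] := fF.
have [k1 c1 s1 _] := member_end (h d1 (mem_head _ _)).
have [|k2 c2 s2 _] := @member_end k W d2; first by apply: h; rewrite !inE eqxx orbT.
have [|k3 c3 s3 _] := @member_end k W d3; first by apply: h; rewrite !inE eqxx !orbT.
have [||||||A [B [C [t [cA cB cC] _ _]]]] :=
  @cyclic_triple_of_nonconn T c noF s _ _ _ k1 k2 k3 _ _ _ n12 n13 n23; rewrite ?c1 ?c2 ?c3 //.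
- exact: disjointW s1 s2 D12.
- exact: disjointW s1 s3 D13.
- exact: disjointW s2 s3 D23.
by exists A, B, C.
Qed.

(** Three pairwise unjoined ends contain a cyclic triple, and the fourth end is joined to it, hence
    to one of the three. *)
Lemma four_not_disconnected W F : path_family (triple_bound hub_bound) W F -> size F = 4 ->
  ~~ disconnected c F.
Proof.
move=> fF; case: F fF => [|d1 [|d2 [|d3 [|d4 [|? ?]]]]] //= fF _.
apply/negP; have := family_pairwise fF; rewrite /disconnected /= !andbT -!andbA.
move=> /and5P[D12 D13 D14 D23 /andP[D24 D34]] /and5P[n12 n13 n14 n23 /andP[n24 n34]].
have [_ h] := fF.
have [k1 c1 s1 _] := member_end (h d1 (mem_head _ _)).
have [|k2 c2 s2 _] := @member_end (triple_bound hub_bound) W d2;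
  first by apply: h; rewrite !inE eqxx orbT.
have [|k3 c3 s3 _] := @member_end (triple_bound hub_bound) W d3;
  first by apply: h; rewrite !inE eqxx !orbT.
have [|k4 c4 s4 _] := @member_end (triple_bound hub_bound) W d4;
  first by apply: h; rewrite !inE eqxx !orbT.
have [||||||A [B [C [t [cA cB cC] sA sBC]]]] :=
  @cyclic_triple_of_nonconn T c noF hub_bound _ _ _ k1 k2 k3 _ _ _ n12 n13 n23;
  rewrite ?c1 ?c2 ?c3 //.
- exact: disjointW s1 s2 D12.
- exact: disjointW s1 s3 D13.
- exact: disjointW s2 s3 D23.
have far Z d : Z \subset d.2 -> ~~ conn d.2 d4.2 -> ~~ conn d4.2 Z.
  by move=> sZ; apply: contra; rewrite conn_sym; apply: conn_sub.
have dis Z d : Z \subset d.2 -> d.2 \subset d.1.1 -> [disjoint d.1.1 & d4.1.1] ->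
    [disjoint d4.2 & Z].
  by move=> sZ sd D; rewrite disjoint_sym; apply: disjointW (subset_trans sZ sd) s4 D.
have [[_ _ _] [AB BC CA] _] := t.
have : [|| conn d4.2 A, conn d4.2 B | conn d4.2 C].
  apply: (clique_meets_triple noF AB BC CA); rewrite ?cA ?cB ?cC ?c4 //.
  - exact: dis sA s1 D14.
  - by case/orP: sBC => /andP[h1 h2]; [apply: dis h1 s2 D24 | apply: dis h1 s3 D34].
  - by case/orP: sBC => /andP[h1 h2]; [apply: dis h2 s3 D34 | apply: dis h2 s2 D24].
  - by do 3!apply: leq_trans (leq_big _); rewrite mulSn -addnA leq_addr.
have nA := far _ _ sA n14.
have [nB nC] : ~~ conn d4.2 B /\ ~~ conn d4.2 C.
  by case/orP: sBC => /andP[h1 h2]; split; by [apply: far h1 _ | apply: far h2 _].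
by rewrite (negbTE nA) (negbTE nB) (negbTE nC).
Qed.

Lemma cards_le_compl n X Y : #|T| = 2 * n - 1 -> ~: X \subset Y -> #|Y| < n -> n <= #|X|.
Proof. by move=> cT /subset_leq_card; have := cardsC X; rewrite cT; clear; lia. Qed.

(** The whole triple and the bridge are reserved, so the paths miss fewer than [N + 3 * s + 8]
    vertices and cover at least n. The bound on s makes A and C large enough to absorb the uncovered
    vertices, those of B' and those of the bridge. *)
Lemma path_from_bridge n N s A B C : #|T| = 2 * n - 1 ->
  (forall S, N <= #|S| -> exists Q, [/\ Q \subset S,
     #|Q| = triple_bound hub_bound + triple_bound hub_bound & rclique Q]) ->
  cyclic_triple A B C -> bridge A B -> #|A| = s -> #|B| = s -> #|C| = s ->
  4 * N + 5 * hub_bound + 300 <= s -> N + 3 * s + 8 <= n -> red_path n.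
Proof.
move=> cT HN ABC [x [x' [m [y' [y [[xA x'A y'B yB] tl ul cm]]]]]] cA cB cC cs cn.
set l := x :: x' :: m ++ [:: y'; y] in tl ul; pose L := [set z in l].
have cL : #|L| <= 7.
  by apply: leq_trans (cards_seq _) _; rewrite /l /= size_cat /=; clear -cm; lia.
have [[kA kB kC] [AB BC CA] _] := ABC.
have sL (Z : {set T}) : #|Z| <= #|Z :\: L| + 7.
  by apply: leq_trans (leq_cardD Z L) _; rewrite leq_add2l.
have [|B' sB cB'] := @subset_card T (B :\: L) (hub_bound + 17).
  by have := sL B; clear -cB cs; lia.
pose A' := A :\: L; pose C' := C :\: L.
have sBB : B' \subset B := subset_trans sB (subsetDl _ _).
have [sA' sC'] : A' \subset A /\ C' \subset C by rewrite !subsetDl.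
have cA' : s <= #|A'| + 7 by rewrite -cA.
have cC' : s <= #|C'| + 7 by rewrite -cC.
have [AB' BC' CA'] : [/\ blue2 A' B', blue2 B' C' & blue2 C' A'].
  by split; [apply: blue2_sub AB | apply: blue2_sub BC | apply: blue2_sub CA].
have dAB : [disjoint A' & B'].
  by apply: blue2_disjoint AB'; clear -cA' cs; lia.
have dBC : [disjoint B' & C'].
  by apply: blue2_disjoint BC'; rewrite cB'; clear; lia.
have mL z : (z \in L) = (z \in l) by rewrite in_set.
have lA z : z \in l -> z \notin A' by move=> zl; rewrite in_setD mL zl.
have lC z : z \in l -> z \notin C' by move=> zl; rewrite in_setD mL zl.
have lB z : z \in l -> z \notin B'.
  by move=> zl; apply/negP=> /(subsetP sB); rewrite in_setD mL zl.
have lk : link A' x x' m y' y B'.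
  split=> //.
  - by apply: rclique_sub kA; rewrite !subUset !sub1set xA x'A.
  - by apply: rclique_sub kB; rewrite !subUset !sub1set yB y'B.
  - by move=> z zl; rewrite inE negb_or lA ?lB.
pose W := ~: (A' :|: B' :|: C' :|: L).
have kpos := triple_bound_gt0 hub_bound.
have [F [fF sF uF]] := @family_exists T c _ 3 N W kpos HN (@four_not_disconnected W).
have WD (Z : {set T}) : Z \subset W ->
    [/\ [disjoint Z & A'], [disjoint Z & B'], [disjoint Z & C'] & [disjoint Z & L]].
  by move=> sZ; split; apply: disjointWl sZ _; apply/pred0P=> z /=;
    apply/negP=> /andP[/[swap] zz]; rewrite in_setC !in_setU zz ?orbT.
have hatY Y : rclique Y -> #|Y| = triple_bound hub_bound -> Y \subset W ->
    [\/ attached 17 Y A', attached 17 Y B' | attached 17 Y C'].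
  move=> kY cY /WD[dA dB dC _].
  have [|[DA cDA nA]] := attachedPn c 17 Y A'; first exact: Or31.
  have [|[DB cDB nB]] := attachedPn c 17 Y B'; first exact: Or32.
  have [|[DC cDC nC]] := attachedPn c 17 Y C'; first exact: Or33.
  have sub (Z D : {set T}) : Z :\: D \subset Z by apply: subsetDl.
  have : [|| conn Y (A' :\: DA), conn Y (B' :\: DB) | conn Y (C' :\: DC)].
    apply: (clique_meets_triple noF) => //.
    - exact: blue2_sub (sub _ _) (sub _ _) AB'.
    - exact: blue2_sub (sub _ _) (sub _ _) BC'.
    - exact: blue2_sub (sub _ _) (sub _ _) CA'.
    - exact: disjointWr (sub _ _) dA.
    - exact: disjointWr (sub _ _) dB.
    - exact: disjointWr (sub _ _) dC.
    - by have := leq_cardD A' DA; clear -cA' cDA cs; lia.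
    - by have := leq_cardD B' DB; clear -cB' cDB cs; lia.
    - by have := leq_cardD C' DC; clear -cC' cDC cs; lia.
    - rewrite cY; do 3!apply: leq_trans (leq_big _).
      by rewrite mulSn -addnA leq_addr.
  by rewrite (negbTE nA) (negbTE nB) (negbTE nC).
have ends d : d \in F -> [/\ dpath d.1.1 d.1.2 d.2, d.1.1 \subset W &
    forall Y, Y \in [:: d.1.2; d.2] ->
      [\/ attached 17 Y A', attached 17 Y B' | attached 17 Y C']].
  move=> dF; have [_ /(_ d dF) md] := fF.
  have [kX cX _ sX] := member_start md; have [kY cY _ sY] := member_end md.
  have [p _ _ sW] := md; split=> // Y.
  by rewrite !inE => /orP[]/eqP->; apply: hatY.
pose u := N + hub_bound + 40.
have cover (R : {set T}) : R \subset W ->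
    (forall z, z \in W -> z \notin R -> z \in uncovered W F) ->
    #|~: (R :|: A' :|: C')| <= u /\ n <= #|R|.
  move=> sR hR; split.
    apply: (@leq_trans #|uncovered W F :|: B' :|: L|).
      apply: subset_leq_card; apply/subsetP=> z; rewrite !(in_setU, in_setC) !negb_or.
      move=> /andP[/andP[zR zA] zC].
      have [zL|zL] := boolP (z \in L); first by rewrite orbT.
      have [zB|zB] := boolP (z \in B'); first by rewrite orbT.
      by rewrite hR // in_setC !in_setU !negb_or zA zB zC.
    have := cardsU (uncovered W F :|: B') L; have := cardsU (uncovered W F) B'.
    by rewrite /u; clear -uF cB' cL; lia.
  apply: (@cards_le_compl n R (uncovered W F :|: (A' :|: B' :|: C' :|: L))) => //.
    apply/subsetP=> z; rewrite in_setC in_setU => zR.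
    have [zW|] := boolP (z \in W); first by rewrite hR.
    by rewrite in_setC negbK => ->; rewrite orbT.
  have := cardsU (uncovered W F) (A' :|: B' :|: C' :|: L).
  have := cardsU (A' :|: B' :|: C') L; have := cardsU (A' :|: B') C'; have := cardsU A' B'.
  have := subset_leq_card sA'; have := subset_leq_card sC'.
  by rewrite cA cC cB'; clear -uF cL cs cn; lia.
have [c4A c4C] : 4 * u + 21 <= #|A'| /\ 4 * u + 21 <= #|C'|.
  by rewrite /u; clear -cA' cC' cs; lia.
case: F fF sF uF ends cover => [|d1 [|d2 [|d3 [|? ?]]]] //= fF _ uF ends cover.
- have [|z zW _|_] := cover set0; first exact: sub0set.
    by rewrite inE zW.
  by rewrite cards0; clear -cn; lia.
- have [p sW _] := ends d1 (mem_head _ _).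
  have [z zW zR|_ cR] := cover d1.1.1 sW; first by rewrite inE zW /= zR.
  exact: red_path_dpath p cR.
- have [p1 sW1 h1] := ends d1 (mem_head _ _).
  have [|p2 sW2 h2] := ends d2; first by rewrite !inE eqxx orbT.
  have sR : d1.1.1 :|: d2.1.1 \subset W by rewrite subUset sW1.
  have [z zW|cU cR] := cover _ sR.
    by rewrite in_setU negb_or inE zW /= => /andP[-> ->].
  have [dA dB dC dL] := WD _ sR.
  have leq6 Y : [\/ attached 17 Y A', attached 17 Y B' | attached 17 Y C'] ->
      [\/ attached 6 Y A', attached 6 Y B' | attached 6 Y C'].
    by case=> h; [apply: Or31 | apply: Or32 | apply: Or33]; apply: attached_leq h.
  apply: (two_paths noF (u := u) cT lk cm (rclique_sub sC' kC) CA' dAB dBC _ dA dB dC p1 p2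
    (family_disjoint fF) (leq6 _ (h1 _ _)) (leq6 _ (h2 _ _)) _ _ _ cU cR).
  + by move=> z zl; rewrite in_setU negb_or lC // andbT; rewrite (disjointFl dL) // mL.
  + by rewrite !inE eqxx orbT.
  + by rewrite !inE eqxx orbT.
  + by rewrite cB'; clear; lia.
  + by clear -c4A; lia.
  + by clear -c4C; lia.
- have [p1 sW1 h1] := ends d1 (mem_head _ _).
  have [|p2 sW2 h2] := ends d2; first by rewrite !inE eqxx orbT.
  have [|p3 sW3 h3] := ends d3; first by rewrite !inE eqxx !orbT.
  have sR : d1.1.1 :|: d2.1.1 :|: d3.1.1 \subset W by rewrite !subUset sW1 sW2.
  have [z zW|cU cR] := cover _ sR.
    by rewrite !in_setU !negb_or inE zW /= -andbA => /and3P[-> -> ->].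
  have [dA dB dC dL] := WD _ sR.
  have /= := family_pairwise fF; rewrite !andbT => /andP[/andP[D12 D13] D23].
  apply: (three_paths noF (u := u) cT lk cm (rclique_sub sC' kC) CA' dAB dBC _ dA dB dC p1 p2 p3
    D12 D13 D23 _ _ c4A c4C cU cR).
  + by move=> z zl; rewrite in_setU negb_or lC // andbT; rewrite (disjointFl dL) // mL.
  + move=> Y; rewrite !inE => hY.
    have : [|| Y \in [:: d1.1.2; d1.2], Y \in [:: d2.1.2; d2.2] | Y \in [:: d3.1.2; d3.2]].
      by rewrite !inE -!orbA.
    by case/or3P=> [/h1|/h2|/h3].
  + by rewrite cB'; clear; lia.
Qed.

(** If all disjoint red cliques of size [big h] are joined, paths merge until a single one misses
    fewer than n vertices. Otherwise an unjoined pair yields hubs with an arrow between them, and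
    three pairwise unjoined ends cannot occur, so at most two paths remain. *)
Lemma path_without_triples n s N N' : #|T| = 2 * n - 1 ->
  (forall A B C, cyclic_triple A B C -> #|A| = s -> #|B| = s -> #|C| = s -> False) ->
  let k := triple_bound s in let h := k + 4 * N + 40 in
  (forall S, N <= #|S| -> exists Q, [/\ Q \subset S, #|Q| = k + k & rclique Q]) ->
  (forall S, N' <= #|S| -> exists Q, [/\ Q \subset S, #|Q| = big h + big h & rclique Q]) ->
  N' < n -> N + 2 * h < n -> red_path n.
Proof.
move=> cT noT k h HN HN' cn' cn; have kpos : 0 < k := triple_bound_gt0 s.
have [[E1 [E2 [k1 k2 dE c1 [c2 nE]]]]|allconn] := classic (exists E1 E2 : {set T},
  [/\ rclique E1, rclique E2, [disjoint E1 & E2], #|E1| = big h & #|E2| = big h /\ ~~ conn E1 E2]);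
  last first.
  have [||F [fF sF uF]] := @family_exists T c (big h) 1 N' setT _ HN' _.
  - by apply: leq_trans (leq_big _); rewrite /h; clear -kpos; lia.
  - move=> F fF; case: F fF => [|d1 [|d2 [|? ?]]] //= fF _; apply/negP=> /= /andP[/andP[n12 _] _].
    have [_ hm] := fF; have [q1 e1 s1 _] := member_end (hm d1 (mem_head _ _)).
    have [|q2 e2 s2 _] := @member_end (big h) setT d2; first by apply: hm; rewrite !inE eqxx orbT.
    apply: allconn; exists d1.2, d2.2; split=> //.
    exact: disjointW s1 s2 (family_disjoint fF).
  case: F fF sF uF => [|d [|? ?]] //= [_ hm] _ uF.
    have := cardsC (set0 : {set T}); rewrite cards0 cT.
    have -> : ~: set0 = uncovered [set: T] [::] by apply/setP=> z; rewrite !inE.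
    by clear -uF cn'; lia.
  have [p _ _ _] := hm d (mem_head _ _); apply: red_path_dpath p _.
  apply: (@cards_le_compl n _ (uncovered setT [:: d])) => //; last by clear -uF cn'; lia.
  by apply/subsetP=> z; rewrite !inE /= andbT.
have [A [C [sA sC cA cC oAC]]] := orient dE nE (eq_leq (esym c1)) (eq_leq (esym c2)).
have {oAC} : exists A C : {set T}, [/\ [/\ rclique A, rclique C & blue2 A C], [disjoint A & C],
    ~~ conn A C, #|A| = h & #|C| = h].
  have nAC : ~~ conn A C by apply: contra nE; apply: conn_sub.
  have dAC : [disjoint A & C] by apply: disjointW sA sC dE.
  have kA := rclique_sub sA k1; have kC := rclique_sub sC k2.
  by case: oAC => bl; [exists A, C | exists C, A; rewrite conn_sym disjoint_sym].
case=> {E1 E2 k1 k2 dE c1 c2 nE A C sA sC cA cC} A [C [[kA kC AC] dAC nAC cA cC]].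
pose W := ~: (A :|: C).
have WD (Z : {set T}) : Z \subset W -> [disjoint Z & A] /\ [disjoint Z & C].
  by move=> sZ; split; apply: disjointWl sZ _; apply/pred0P=> z /=;
    apply/negP=> /andP[/[swap] zz]; rewrite in_setC !in_setU zz ?orbT.
have [|F [fF sF uF]] := @family_exists T c k 2 N W kpos HN _.
  move=> F fF F3; apply/negP=> dF.
  by have [A' [B' [C' [t a b d]]]] := three_disconnected fF F3 dF (leqnn k); apply: noT t a b d.
(* An end attached to neither hub would be a third clique unjoined to large parts of both, and a
   cyclic triple would arise. *)
have hatY Y : rclique Y -> #|Y| = k -> Y \subset W -> attached 6 Y A \/ attached 6 Y C.
  move=> kY cY /WD[dA dC].
  have [|[DA cDA nA]] := attachedPn c 6 Y A; first by left.
  have [|[DC cDC nC]] := attachedPn c 6 Y C; first by right.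
  have sub (Z D : {set T}) : Z :\: D \subset Z by apply: subsetDl.
  have [|||||||A' [B' [C' [t [cA' cB' cC'] _ _]]]] := @cyclic_triple_of_nonconn T c noF s
    _ _ _ kY (rclique_sub (sub A DA) kA) (rclique_sub (sub C DC) kC) _ _ _ nA nC.
  - exact: disjointWr (sub _ _) dA.
  - exact: disjointWr (sub _ _) dC.
  - exact: disjointW (sub _ _) (sub _ _) dAC.
  - by apply: contra nAC; apply: conn_sub.
  - by rewrite cY.
  - by have := leq_cardD A DA; rewrite -/k cA /h; clear -cDA; lia.
  - by have := leq_cardD C DC; rewrite -/k cC /h; clear -cDC; lia.
  by case: (noT _ _ _ t cA' cB' cC').
have ends d : d \in F -> [/\ dpath d.1.1 d.1.2 d.2, d.1.1 \subset W &
    attached 6 d.2 A \/ attached 6 d.2 C].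
  move=> dF; have [_ /(_ d dF) md] := fF.
  have [kY cY _ sY] := member_end md; have [p _ _ sW] := md.
  by split=> //; apply: hatY.
have cover (R : {set T}) : R \subset W ->
    (forall z, z \in W -> z \notin R -> z \in uncovered W F) ->
    #|~: (R :|: A :|: C)| <= N /\ n <= #|R|.
  move=> sR hR; split.
    apply: leq_trans (ltnW uF); apply: subset_leq_card; apply/subsetP=> z.
    rewrite !(in_setU, in_setC) !negb_or => /andP[/andP[zR zA] zC].
    by rewrite hR // in_setC in_setU negb_or zA zC.
  apply: (@cards_le_compl n R (uncovered W F :|: (A :|: C))) => //.
    apply/subsetP=> z; rewrite in_setC in_setU => zR.
    have [zW|] := boolP (z \in W); first by rewrite hR.
    by rewrite in_setC negbK => ->; rewrite orbT.
  have := cardsU (uncovered W F) (A :|: C); have := cardsU A C.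
  by rewrite cA cC; clear -uF cn; lia.
case: F fF sF uF ends cover => [|d1 [|d2 [|? ?]]] //= fF _ uF ends cover.
- have [|z zW _|_] := cover set0; first exact: sub0set.
    by rewrite inE zW.
  by rewrite cards0; clear -cn; lia.
- have [p sW _] := ends d1 (mem_head _ _).
  have [z zW zR|_ cR] := cover d1.1.1 sW; first by rewrite inE zW /= zR.
  exact: red_path_dpath p cR.
have [p1 sW1 h1] := ends d1 (mem_head _ _).
have [|p2 sW2 h2] := ends d2; first by rewrite !inE eqxx orbT.
have sR : d1.1.1 :|: d2.1.1 \subset W by rewrite subUset sW1.
have [z zW|cU cR] := cover _ sR.
  by rewrite in_setU negb_or inE zW /= => /andP[-> ->].
have [dA dC] := WD _ sR; have d12 := family_disjoint fF.
have d21 : [disjoint d2.1.1 & d1.1.1] by rewrite disjoint_sym.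
have [[dA1 dC1] [dA2 dC2]] := (WD _ sW1, WD _ sW2).
have cA4 : 4 <= #|A| by rewrite cA /h; clear; lia.
have cC4 : 4 <= #|C| by rewrite cC /h; clear; lia.
have cA8 : 4 * N + 8 <= #|A| by rewrite cA /h; clear; lia.
have cC8 : 4 * N + 8 <= #|C| by rewrite cC /h; clear; lia.
case: h1 h2 => a1 [] a2.
- have [E _ p] := dpath_same_hub kA cA4 p1 p2 d12 dA a1 a2.
  by apply: red_path_dpath p _; apply: leq_trans cR _; rewrite subset_leq_card ?subsetUl.
- exact: (absorb_hubs noF cT p1 p2 d12 kA kC AC dA1 dC1 dA2 dC2
    (attached_conn a1) (attached_conn a2) cA8 cC8 cU).
- apply: (absorb_hubs noF cT p2 p1 d21 kA kC AC dA2 dC2 dA1 dC1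
    (attached_conn a2) (attached_conn a1) cA8 cC8).
  by rewrite [d2.1.1 :|: _]setUC.
- have [E _ p] := dpath_same_hub kC cC4 p1 p2 d12 dC a1 a2.
  by apply: red_path_dpath p _; apply: leq_trans cR _; rewrite subset_leq_card ?subsetUl.
Qed.

End Upper.

Theorem long_red_path : exists n0, forall n, n0 <= n ->
  forall (T : finType) (c : {set T} -> bool), #|T| = 2 * n - 1 -> no_fano c -> red_path c n.
Proof.
have [N1 H1] := large_red_clique (triple_bound hub_bound + triple_bound hub_bound).
pose s := 4 * N1 + 5 * hub_bound + 300.
have [N2 H2] := large_red_clique (triple_bound s + triple_bound s).
pose h := triple_bound s + 4 * N2 + 40.
have [N3 H3] := large_red_clique (big h + big h).
exists (N1 + 3 * s + 8 + N2 + 2 * h + N3 + 1) => n nn T c cT noF.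
have [[A [B [C [t cA cB cC]]]]|noT] := classic (exists A B C : {set T},
    [/\ cyclic_triple c A B C, #|A| = s, #|B| = s & #|C| = s]); last first.
  apply: (path_without_triples noF cT (s := s) (N := N2) (N' := N3)).
  - by move=> A B C t cA cB cC; apply: noT; exists A, B, C.
  - by move=> S; apply: H2.
  - by move=> S; apply: H3.
  - by clear -nn; lia.
  - by rewrite -/h; clear -nn; lia.
have nN : N1 + 3 * s + 8 <= n by clear -nn; lia.
have HN S := H1 T c S noF.
have [bAB|nAB] := classic (bridge c A B).
  exact: (path_from_bridge noF cT HN t bAB cA cB cC (leqnn _) nN).
have t' := cyclic_triple_rot t; have t'' := cyclic_triple_rot t'.
have [bBC|nBC] := classic (bridge c B C).
  exact: (path_from_bridge noF cT HN t' bBC cB cC cA (leqnn _) nN).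
have [bCA|nCA] := classic (bridge c C A).
  exact: (path_from_bridge noF cT HN t'' bCA cC cA cB (leqnn _) nN).
have s30 : 30 <= s by rewrite /s; clear; lia.
by apply: (exact_red_path noF cT t _ _ _ nAB nBC nCA); rewrite ?cA ?cB ?cC.
Qed.

(** * Coordinates of the Fano plane *)

Section Fano.

Context (V : finType) (F : hypergraph3 V).
Hypothesis hF : fano_plane F.
Implicit Types (u v w p q r x y z : V).

Definition line p q r := [set p; q; r] \in edges F.

Lemma line_uniq p q r : line p q r -> uniq [:: p; q; r].
Proof.
move=> /edges_card3 c3; apply/card_uniqP; rewrite /= -[RHS]c3.
by rewrite -cardsE; apply: eq_card => v; rewrite !inE orbA.
Qed.

Lemma line_perms p q r : line p q r ->
  [/\ line p r q, line q p r, line q r p, line r p q & line r q p].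
Proof.
rewrite /line => h; split.
- by rewrite set3C23.
- by rewrite set3C12.
- by rewrite -set3_rot.
- by rewrite set3_rot.
- by rewrite set3C12 -set3_rot.
Qed.

Lemma edge_unique e e' u v : e \in edges F -> e' \in edges F -> u != v ->
  u \in e -> v \in e -> u \in e' -> v \in e' -> e = e'.
Proof.
move=> he he' uv ue ve ue' ve'; have [_ _ /(_ u v uv)[l [_ hl]]] := hF.
have H f : f \in edges F -> u \in f -> v \in f -> l = f.
  by move=> hf uf vf; apply: hl; rewrite subUset !sub1set uf.
exact: etrans (esym (H e he ue ve)) (H e' he' ue' ve').
Qed.

Lemma line_third_unique p q r s : line p q r -> line p q s -> r != s -> False.
Proof.
move=> h1 h2 rs; have := line_uniq h1; rewrite /= !inE negb_or andbT => /andP[/andP[pq pr] qr].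
have E : [set p; q; r] = [set p; q; s].
  by apply: (edge_unique h1 h2 pq); rewrite !inE eqxx ?orbT.
have : r \in [set p; q; s] by rewrite -E ?inE ?eqxx ?orbT.
by rewrite !inE (negbTE rs) (eq_sym r p) (negbTE pr) (eq_sym r q) (negbTE qr).
Qed.

Lemma line_third p q : p != q -> exists r, line p q r.
Proof.
move=> pq; have [_ _ /(_ p q pq)[e [[he sub] _]]] := hF.
have : #|e :\: [set p; q]| = 1.
  have := cardsID [set p; q] e; rewrite (setIidPr sub) cards2 pq (edges_card3 he); clear; lia.
move=> /eqP/cards1P[r hr]; exists r; rewrite /line -(_ : e = [set p; q; r]) //.
by rewrite -hr -(setID e [set p; q]) (setIidPr sub) setDUl setDv set0U; congr (_ :|: _);
  rewrite setDDl setUid.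
Qed.

Ltac repeated us := exfalso; move: us; rewrite /= !inE ?eqxx /= ?orbT ?andbF /=; by [].

Ltac clash us :=
  match goal with
  | H1 : is_true (line ?p ?q ?r), H2 : is_true (line ?p ?q ?s) |- _ =>
    exfalso; apply: (line_third_unique H1 H2); solve [distinct us]
  end.

Lemma fano_coordinates : exists x y z a b d e,
  [/\ uniq [:: x; y; z; a; b; d; e], forall v, v \in [:: x; y; z; a; b; d; e]
    & [/\ line x y z, line x a b, line x d e, line y a d
      & [/\ line y b e, line z a e & line z b d]]].
Proof.
have cV : #|V| = 7 by case: hF.
have new (s : seq V) : size s < 7 -> exists v, v \notin s.
  move=> cs; have [|v _ vs] := @pick1 V setT [set v in s].
    by rewrite cardsT cV (leq_ltn_trans (cards_seq s)).
  by exists v; rewrite inE in vs.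
have [x _] := new [::] isT; have [y xy] := new [:: x] isT.
have {}xy : x != y by rewrite inE eq_sym in xy.
have [z Lz] := line_third xy; have uz := line_uniq Lz.
have [a az] := new [:: x; y; z] isT.
have xa : x != a by move: az; rewrite !inE eq_sym; case: (x == a).
have [b Lb] := line_third xa.
have [L1 L2 L3 L4 L5] := line_perms Lz; have [M1 M2 M3 M4 M5] := line_perms Lb.
have [ay aZ] : a != y /\ a != z by move: az; rewrite !inE !negb_or => /and3P[].
have ub := line_uniq Lb.
have bY : b != y by apply/eqP=> E; subst b; apply: (line_third_unique Lz M1); rewrite eq_sym.
have bZ : b != z by apply/eqP=> E; subst b; apply: (line_third_unique L1 M1); rewrite eq_sym.
have u5 : uniq [:: x; y; z; a; b].
  move: uz ub az bY bZ; rewrite /= !inE !negb_or !andbT.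
  move=> /andP[/andP[-> ->] ->] /andP[/andP[-> ->] ->] /and3P[_ h1 h2] h3 h4.
  by rewrite ![y == _]eq_sym ![z == _]eq_sym h1 h2 h3 h4.
have [d dn] := new [:: x; y; z; a; b] isT.
have xd : x != d by move: dn; rewrite !inE eq_sym; case: (x == d).
have [e Le] := line_third xd; have [N1 N2 N3 N4 N5] := line_perms Le.
have ud := line_uniq Le.
have u6 : uniq [:: d; x; y; z; a; b] by rewrite cons_uniq dn.
have en : e \notin [:: x; y; z; a; b].
  rewrite !inE; apply/negP=> /orP[/eqP E|/or4P[/eqP E|/eqP E|/eqP E|/eqP E]];
    subst e; first by repeated ud.
  all: try by clash u6.
have ed : e != d by distinct ud.
have u7 : uniq [:: d; e; x; y; z; a; b].
  by move: u6; rewrite cons_uniq => /andP[dn' u5']; rewrite !cons_uniq inE negb_or eq_sym ed dn' en.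
have inV v : v \in [:: d; e; x; y; z; a; b].
  have : [set v in [:: d; e; x; y; z; a; b]] == setT.
    by rewrite eqEcard subsetT cardsT cV cardsE (card_uniqP u7).
  by move/eqP/setP/(_ v); rewrite !inE.
wlog Ly : d e Le N1 N2 N3 N4 N5 xd ud {dn u6 en ed} u7 inV / line y a d.
  move=> W; have ya : y != a by distinct u7.
  have [w Lw] := line_third ya; have [P1 P2 P3 P4 P5] := line_perms Lw.
  have uw := line_uniq Lw.
  have := inV w; rewrite !inE; case/or3P=> [/eqP E|/eqP E|/or4P[/eqP E|/eqP E|/eqP E|/orP[]/eqP E]];
    subst w; try (by repeated uw); try by clash u7.
  - by apply: (W d e).
  - have u7' : uniq [:: e; d; x; y; z; a; b].
      by move: u7; rewrite !cons_uniq !inE !negb_or (eq_sym d e) => /and3P[/andP[-> ->] -> ->].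
    apply: (W e d) => //; [by distinct u7 | exact: line_uniq N1 |].
    by move=> v; have := inV v; rewrite !inE orbCA.
have [P1 P2 P3 P4 P5] := line_perms Ly.
have third p q r : p != q -> (forall w, line p q w -> w != r -> False) -> line p q r.
  move=> /line_third[w Lw] h; have [<-//|wr] := eqVneq w r; by case: (h w Lw wr).
have Q0 : line y b e.
  apply: third; first by distinct u7.
  move=> w Lw wr; have [Q1 Q2 Q3 Q4 Q5] := line_perms Lw; have uw := line_uniq Lw.
  have := inV w; rewrite !inE; case/or3P=> [/eqP E|/eqP E|/or4P[/eqP E|/eqP E|/eqP E|/orP[]/eqP E]];
    subst w; try (by rewrite eqxx in wr); try (by repeated uw); by clash u7.
have [Q1 Q2 Q3 Q4 Q5] := line_perms Q0.
have R0 : line z a e.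
  apply: third; first by distinct u7.
  move=> w Lw wr; have [R1 R2 R3 R4 R5] := line_perms Lw; have uw := line_uniq Lw.
  have := inV w; rewrite !inE; case/or3P=> [/eqP E|/eqP E|/or4P[/eqP E|/eqP E|/eqP E|/orP[]/eqP E]];
    subst w; try (by rewrite eqxx in wr); try (by repeated uw); by clash u7.
have [R1 R2 R3 R4 R5] := line_perms R0.
have S0 : line z b d.
  apply: third; first by distinct u7.
  move=> w Lw wr; have [S1 S2 S3 S4 S5] := line_perms Lw; have uw := line_uniq Lw.
  have := inV w; rewrite !inE; case/or3P=> [/eqP E|/eqP E|/or4P[/eqP E|/eqP E|/eqP E|/orP[]/eqP E]];
    subst w; try (by rewrite eqxx in wr); try (by repeated uw); by clash u7.
exists x, y, z, a, b, d, e; split=> //.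
  by rewrite -(rot_uniq 5).
by move=> v; have := inV v; rewrite -(mem_rot 2).
Qed.

Lemma fano_not_two_colourable (f : V -> bool) :
  exists2 e, e \in edges F & exists k, forall v, v \in e -> f v = k.
Proof.
have [x [y [z [a [b [d [e [_ _ [L1 L2 L3 L4 [L5 L6 L7]]]]]]]]]] := fano_coordinates.
have mono p q r : line p q r -> f p = f q -> f q = f r ->
    exists2 e, e \in edges F & exists k, forall v, v \in e -> f v = k.
  move=> L E1 E2; exists [set p; q; r] => //; exists (f r) => v.
  by rewrite !inE => /orP[/orP[]|]/eqP->; rewrite ?E1 ?E2.
move: (mono _ _ _ L1) (mono _ _ _ L2) (mono _ _ _ L3) (mono _ _ _ L4) (mono _ _ _ L5)
  (mono _ _ _ L6) (mono _ _ _ L7).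
by case: (f x); case: (f y); case: (f z); case: (f a); case: (f b); case: (f d); case: (f e);
  move=> h1 h2 h3 h4 h5 h6 h7; (exact: h1 || exact: h2 || exact: h3 || exact: h4 || exact: h5
    || exact: h6 || exact: h7).
Qed.

(** Two points of S lie on one of the seven listed lines, which cover all pairs, and an edge is
    determined by two of its points. *)
Lemma edge_is_line S x y z a b d e :
  (forall v, v \in [:: x; y; z; a; b; d; e]) ->
  line x y z -> line x a b -> line x d e -> line y a d -> line y b e -> line z a e ->
  line z b d -> S \in edges F ->
  S \in [:: [set x; y; z]; [set x; a; b]; [set x; d; e]; [set y; a; d]; [set y; b; e];
            [set z; a; e]; [set z; b; d]].
Proof.
move=> inV L1 L2 L3 L4 L5 L6 L7 hS.
have /card_gt0P[u uS] : 0 < #|S| by rewrite (edges_card3 hS).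
have [|v vS vu] := @pick1 V S [set u]; first by rewrite cards1 (edges_card3 hS).
have {vu} uv : u != v by rewrite inE eq_sym in vu.
have eqL p q r : line p q r -> u \in [set p; q; r] -> v \in [set p; q; r] -> S = [set p; q; r].
  by move=> L; apply: edge_unique uS vS.
move: (inV u) (inV v); rewrite !(inE, in_cons) => hu hv.
move: uv uS vS eqL.
do 6?[case/orP: hu => [/eqP->|hu]]; last move/eqP: hu => ->;
(do 6?[case/orP: hv => [/eqP->|hv]]; last move/eqP: hv => ->);
move=> uv uS vS eqL; rewrite ?eqxx // in uv *;
first [rewrite (eqL _ _ _ L1); by rewrite ?inE ?eqxx ?orbT
 | rewrite (eqL _ _ _ L2); by rewrite ?inE ?eqxx ?orbT
 | rewrite (eqL _ _ _ L3); by rewrite ?inE ?eqxx ?orbT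
 | rewrite (eqL _ _ _ L4); by rewrite ?inE ?eqxx ?orbT
 | rewrite (eqL _ _ _ L5); by rewrite ?inE ?eqxx ?orbT
 | rewrite (eqL _ _ _ L6); by rewrite ?inE ?eqxx ?orbT
 | rewrite (eqL _ _ _ L7); by rewrite ?inE ?eqxx ?orbT].
Qed.

End Fano.

(** * From blue planes and red paths to copies of hypergraphs *)

Lemma card_triple (T : finType) (x y z : T) : uniq [:: x; y; z] -> #|[set x; y; z]| = 3.
Proof.
move=> /card_uniqP /= <-; apply: eq_card => v; by rewrite !inE orbA.
Qed.

Lemma edge_colour_class N (c : {set 'I_N} -> bool) k (x y z : 'I_N) :
  uniq [:: x; y; z] -> c [set x; y; z] = k ->
  [set x; y; z] \in edges (colour_class (complete3 N) c k).
Proof. by move=> u ck; rewrite inE inE card_triple ?ck ?eqxx. Qed.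

Lemma blue_neq (T : finType) (c : {set T} -> bool) x y z : blue c x y z ->
  [/\ x != y, x != z & y != z].
Proof. by case/andP; rewrite /= !inE negb_or => /and3P[/andP[-> ->] ->]. Qed.

Lemma imset_set3 (T U : finType) (f : T -> U) x y z :
  f @: [set x; y; z] = [set f x; f y; f z].
Proof. by rewrite !imsetU !imset_set1. Qed.

Lemma no_fano_of_no_copy N (c : {set 'I_N} -> bool) (V : finType) (F : hypergraph3 V) :
  fano_plane F -> ~ contains_copy (colour_class (complete3 N) c false) F -> no_fano c.
Proof.
move=> hF ncopy p1 p2 p3 p4 p5 p6 p7 b1 b2 b3 b4 b5 b6 b7; apply: ncopy.
have [x [y [z [a [b [d [e [u7 inV [L1 L2 L3 L4 [L5 L6 L7]]]]]]]]]] := fano_coordinates hF.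
set vs := [:: x; y; z; a; b; d; e] in u7 inV; set ps := [:: p1; p2; p3; p4; p5; p6; p7].
have ups : uniq ps.
  (* The seven blue triples provide all 21 inequalities between the seven points. *)
  have [n1 n2 n3] := blue_neq b1; have [n4 n5 n6] := blue_neq b2; have [n7 n8 n9] := blue_neq b3.
  have [m1 m2 m3] := blue_neq b4; have [m4 m5 m6] := blue_neq b5; have [m7 m8 m9] := blue_neq b6.
  have [l1 l2 l3] := blue_neq b7.
  by rewrite /ps /= !inE !negb_or; split_and; first [done | by rewrite eq_sym].
pose f v := nth p1 ps (index v vs).
exists f.
  move=> v w /eqP; rewrite nth_uniq // ?index_mem ?inV // => /eqP/(congr1 (nth x vs)).
  by rewrite !nth_index ?inV.
have fi i : i < 7 -> f (nth x vs i) = nth p1 ps i by move=> i7; rewrite /f index_uniq.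
have [f0 f1 f2] := And3 (fi 0 isT) (fi 1 isT) (fi 2 isT).
have [f3 f4 f5 f6] := And4 (fi 3 isT) (fi 4 isT) (fi 5 isT) (fi 6 isT).
rewrite /= in f0 f1 f2 f3 f4 f5 f6.
have good q r t : blue c q r t -> [set q; r; t] \in edges (colour_class (complete3 N) c false).
  by case/andP=> u /negbTE; apply: edge_colour_class.
move=> S /(edge_is_line hF inV L1 L2 L3 L4 L5 L6 L7) hS; rewrite !in_cons in_nil orbF in hS.
by do 6?[case/orP: hS => [/eqP->|hS]]; [..|move/eqP: hS => ->];
  rewrite imset_set3 ?f0 ?f1 ?f2 ?f3 ?f4 ?f5 ?f6; apply: good.
Qed.

Lemma tight_nth (T : finType) (c : {set T} -> bool) x0 (s : seq T) i : tight c s ->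
  i.+2 < size s -> red c (nth x0 s i) (nth x0 s i.+1) (nth x0 s i.+2).
Proof.
elim: s i => [|x s IHs] i //; case: i => [|i] /=.
  by case: s {IHs} => [|y [|z s]] //= /andP[].
by move=> /andP[_ ts]; apply: IHs.
Qed.

Lemma tight_path_copy N (c : {set 'I_N} -> bool) n : 0 < n -> red_path c n ->
  contains_copy (colour_class (complete3 N) c true) (tight_path n).
Proof.
move=> n0 [s [us ts ns]]; case: s us ts ns => [|x0 s]; first by case: n n0.
set t := x0 :: s => us ts ns.
exists (fun i : 'I_n => nth x0 t i).
  move=> i j /eqP; rewrite nth_uniq ?(leq_trans (ltn_ord _) ns) // => /eqP; exact: val_inj.
move=> e; rewrite inE => /existsP[x /existsP[y /existsP[z /and3P[/eqP yE /eqP zE /eqP->]]]].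
rewrite imset_set3 yE zE.
have /(tight_nth x0 ts)/andP[u cr] : x.+2 < size t by rewrite -zE (leq_trans (ltn_ord z) ns).
exact: edge_colour_class.
Qed.

(** * The lower bound and the theorem *)

Lemma ramsey_lower n M (V : finType) (F : hypergraph3 V) : 3 <= n -> fano_plane F ->
  ramsey_arrow M (tight_path n) F -> 2 * n - 1 <= M.
Proof.
move=> n3 hF arr; rewrite leqNgt; apply/negP=> ltM.
(* As M is at most 2n - 2, neither side has more than n - 1 vertices; the same cut serves every
   smaller M. *)
pose c (e : {set 'I_M}) := [forall i in e, i < n.-1] || [forall i in e, n.-1 <= i].
have [[f injf hf]|[f injf hf]] := arr c; last first.
  have [e he [k hk]] := fano_not_two_colourable hF (fun v => f v < n.-1).
  have := hf e he; rewrite inE => /andP[_ /eqP/negbT]; apply/negP; rewrite negbK.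
  case: k hk => hk; apply/orP; [left | right]; apply/forall_inP=> i /imsetP[v ve ->].
    exact: hk.
  by rewrite leqNgt hk.
have n0 : 0 < n by lia.
have step i (i2 : i.+2 < n) : (f (Ordinal (ltnW (ltnW i2))) < n.-1) = (f (Ordinal (ltnW i2)) < n.-1)
    /\ (f (Ordinal (ltnW i2)) < n.-1) = (f (Ordinal i2) < n.-1).
  set x := Ordinal (ltnW (ltnW i2)); set y := Ordinal (ltnW i2); set z := Ordinal i2.
  have : [set x; y; z] \in edges (tight_path n).
    by rewrite inE; apply/existsP; exists x; apply/existsP; exists y; apply/existsP; exists z;
      rewrite !eqxx.
  move=> /hf; rewrite inE imset_set3 => /andP[_ /eqP/orP[]/forall_inP h];
    have := (h (f x), h (f y), h (f z)); rewrite !inE !eqxx ?orbT;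
    move=> -[[/(_ isT) h1 /(_ isT) h2] /(_ isT) h3].
    by rewrite h1 h2 h3.
  by rewrite !ltnNge h1 h2 h3.
have const i (ni : i < n) : (f (Ordinal ni) < n.-1) = (f (Ordinal n0) < n.-1).
  elim/ltn_ind: i ni => -[|[|i]] IHi ni.
  - by congr (f _ < _); apply: val_inj.
  - have [h _] := step 0 n3; rewrite (_ : Ordinal ni = Ordinal (ltnW n3)); last exact: val_inj.
    by rewrite -h; congr (f _ < _); apply: val_inj.
  - have [_ h] := step i ni; rewrite -h; apply: IHi; lia.
pose b := f (Ordinal n0) < n.-1.
(* The type has n - 1 elements, written as a successor for [inord]. Shifting the upper side down
   turns a red path inside one side into an injection from n vertices to n - 1. *)
pose g (i : 'I_n) : 'I_(n.-2).+1 := inord (if b then f i : nat else f i - n.-1).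
have fb (i : 'I_n) : (f i < n.-1) = b by case: i => i ni; apply: const.
have gE i : g i = (if b then f i : nat else f i - n.-1) :> nat.
  rewrite /g inordK //; have := fb i; have := ltn_ord (f i).
  by case: ifP => hb; rewrite ?hb; clear -n3 ltM; lia.
have ginj : injective g.
  move=> i j gij; apply/injf/val_inj => /=; have := gE i; rewrite gij gE.
  by have := fb i; have := fb j; case: ifP => hb; rewrite ?hb; clear; lia.
by have := leq_card g ginj; rewrite !card_ord; clear -n3; lia.
Qed.

Theorem theorem1 :
  exists n0 : nat, forall n : nat, n0 <= n ->
  forall (V : finType) (F : hypergraph3 V), fano_plane F ->
  is_ramsey_number (tight_path n) F (2 * n - 1).
Proof.
have [n0 H] := long_red_path; exists (n0 + 3) => n nn V F hF.
have n3 : 3 <= n by clear -nn; lia.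
split; last by move=> M; apply: ramsey_lower.
move=> c; have [h|h] := classic (contains_copy (colour_class (complete3 (2 * n - 1)) c false) F).
  by right.
left; apply: tight_path_copy; first by clear -n3; lia.
apply: H; [by clear -nn; lia | by rewrite card_ord | exact: no_fano_of_no_copy hF h].
Qed.
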